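(* Suppose that $\mathfrak g=\mathfrak g_{-1}\oplus\mathfrak g_0\oplus\mathfrak g_1$ is $|1|$-graded. (1) Let $b_1,b_2\in P$ and $X_1,X_2\in\mathfrak g_{-1}\setminus\{0\}$. If the curves $c^{b_1,X_1}$ and $c^{b_2,X_2}$ coincide as unparametrized curves, then the corresponding local reparametrization $\varphi$ (i.e. $c^{b_2,X_2}(t)=c^{b_1,X_1}(\varphi(t))$ with $\varphi'\neq0$) has the form $\varphi(t)=\frac{At+B}{Ct+D}$, where $\begin{pmatrix}A&B\\C&D\end{pmatrix}\in SL(2,\mathbb R)$. (2) Conversely, if $c=c^{b,X}$ (with $b\in P$, $X\in\mathfrak g_{-1}$) is a parametrized geodesic, then all curves $c\circ\varphi$ with reparametrizations $\varphi$ of the form $\varphi(t)=\frac{At+B}{Ct+D}$, $\begin{pmatrix}A&B\\C&D\end{pmatrix}\in SL(2,\mathbb R)$ (on open intervals where $\varphi$ is defined), are again geodesics if and only if there is $Z\in\mathfrak g_1$ such that $[X,[X,Z]]=X$.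
   Context: $G$ is a real semisimple Lie group with Lie algebra $\mathfrak g$, $P\subset G$ a parabolic subgroup with Lie algebra $\mathfrak p=\mathfrak g_0\oplus\mathfrak g_1$, where $\mathfrak g=\mathfrak g_{-1}\oplus\mathfrak g_0\oplus\mathfrak g_1$ is the corresponding $|1|$-grading ($[\mathfrak g_i,\mathfrak g_j]\subseteq\mathfrak g_{i+j}$, with $\mathfrak g_\ell=0$ for $|\ell|>1$). $G_0\subset P$ is the closed subgroup of elements of $G$ whose adjoint action preserves the grading; each $b\in P$ is uniquely $b_0\exp(Z)$ with $b_0\in G_0$, $Z\in\mathfrak g_1$. For $b\in P$ and $X\in\mathfrak g_{-1}$, $c^{b,X}$ is the curve $c^{b,X}(t)=b\exp(tX)P$ in $G/P$; these are the (generalized) geodesics through $o=eP$ at parameter $0$. In general, the (parametrized) geodesics in $G/P$ are the curves $t\mapsto g\exp(tX)P$, $g\in G$, $X\in\mathfrak g_{-1}$, restricted to open intervals. A local reparametrization is a smooth real function $\varphi$ on an open interval with $\varphi'(t)\neq0$. $SL(2,\mathbb R)$ is the group of real $2\times2$ matrices of determinant $1$.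
   Formalization: In (1) the matrix has determinant equal to the sign of φ' (so it lies in SL(2,R) exactly when φ'>0, and has determinant −1 when φ'<0); as stated the claim fails for φ(t)=−t, since c^{b,−X}(t)=c^{b,X}(−t) while SL(2,R) maps are increasing. *)

(* Defs.v *)
From HB Require Import structures.
From mathcomp Require Import all_boot all_order all_algebra.
From mathcomp Require Import all_classical all_reals all_analysis.

Set Implicit Arguments.
Unset Strict Implicit.
Unset Printing Implicit Defensive.

Import Order.TTheory GRing.Theory Num.Theory.
Import numFieldNormedType.Exports.

Local Open Scope classical_set_scope.
Local Open Scope ring_scope.

(* Meant for open U in finite-dimensional V, where quantifying over every
   direction v amounts to requiring that the differential be C^k. *)
Fixpoint class_Ck (R : realType) (V W : normedModType R) (k : nat)
    (U : set V) (f : V -> W) : Prop :=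
  if k is k'.+1 then
    (forall x, U x -> differentiable f x) /\
    (forall v, class_Ck k' U (fun x => 'd f x v))
  else forall x, U x -> {for x, continuous f}.

Definition smooth_on (R : realType) (V W : normedModType R)
    (U : set V) (f : V -> W) : Prop :=
  forall k, class_Ck k U f.

(* [chart_map] and [chart_inv] are total functions; their values outside
   [chart_dom] and [chart_im] are irrelevant. *)
Record chart (R : realType) (n : nat) (T : topologicalType) := Chart {
  chart_dom : set T;
  chart_map :> T -> 'rV[R]_n;
  chart_inv : 'rV[R]_n -> T;
  chart_dom_open : open chart_dom;
  chart_im_open : open (chart_map @` chart_dom);
  chart_mapK : {in chart_dom, cancel chart_map chart_inv};
  chart_map_continuous :
    forall x, chart_dom x -> {for x, continuous chart_map};
  chart_inv_continuous :
    forall y, (chart_map @` chart_dom) y -> {for y, continuous chart_inv}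
}.

Definition chart_im (R : realType) (n : nat) (T : topologicalType)
  (a : chart R n T) : set 'rV[R]_n := a @` chart_dom a.

HB.mixin Record Topological_isManifold (R : realType) (n : nat) T
    of Topological T := {
  atlas : set (chart R n T);
  manifold_hausdorff : hausdorff_space T;
  manifold_second_countable : @second_countable T;
  atlas_cover : forall x : T, exists2 a, atlas a & chart_dom a x;
  atlas_compatible : forall a b, atlas a -> atlas b ->
    smooth_on (a @` (chart_dom a `&` chart_dom b))
              (fun y => b (chart_inv a y))
}.

#[short(type="manifoldType")]
HB.structure Definition Manifold (R : realType) (n : nat) :=
  {T of Topological_isManifold R n T & Topological T}.

HB.mixin Record GroupManifold_isLieGroup (R : realType) (n : nat) G
    of Group G & Manifold R n G := {
  lie_mul_continuous : continuous (fun p : G * G => (p.1 * p.2)%g);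
  lie_mul_smooth : forall a b c : chart R n G,
    atlas a -> atlas b -> atlas c ->
    smooth_on
      [set u : 'rV[R]_n * 'rV[R]_n | [/\ chart_im a u.1, chart_im b u.2 &
         chart_dom c (chart_inv a u.1 * chart_inv b u.2)%g]]
      (fun u => c (chart_inv a u.1 * chart_inv b u.2)%g);
  lie_inv_continuous : continuous (fun x : G => x^-1%g);
  lie_inv_smooth : forall a b : chart R n G, atlas a -> atlas b ->
    smooth_on [set y | chart_im a y /\ chart_dom b (chart_inv a y)^-1%g]
              (fun y => b (chart_inv a y)^-1%g)
}.

#[short(type="lieGroupType")]
HB.structure Definition LieGroup (R : realType) (n : nat) :=
  {G of GroupManifold_isLieGroup R n G & Group G & Manifold R n G}.

Section LieAlgebra.
Context (R : realType) (n : nat) (G : lieGroupType R n).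

(* The Lie algebra of G is its tangent space at 1, each tangent vector being
   represented by its coordinates in a fixed chart e at 1; hence its carrier
   is 'rV[R]_n. *)
Variable e : chart R n G.

(* The left invariant vector field g |-> T_1(h |-> g h) X, expressed in the
   chart a at the point with coordinates x. *)
Definition left_field (X : 'rV[R]_n) (a : chart R n G) (x : 'rV[R]_n) :
    'rV[R]_n :=
  'd (fun y => a (chart_inv a x * chart_inv e y)%g) (e 1%g) X.

(* Value at 1 of the commutator of the two left invariant vector fields. *)
Definition lie_bracket (X Y : 'rV[R]_n) : 'rV[R]_n :=
  'd (left_field Y e) (e 1%g) X - 'd (left_field X e) (e 1%g) Y.

(* t |-> exp (t X) is the integral curve through 1 of the left invariant
   vector field of X; this determines exp. *)
Definition is_lie_exp (exp : 'rV[R]_n -> G) : Prop :=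
  forall X : 'rV[R]_n,
  [/\ exp 0 = 1%g,
      continuous (fun t : R => exp (t *: X)) &
      forall (a : chart R n G) (t : R),
        atlas a -> chart_dom a (exp (t *: X)) ->
        is_derive t (1 : R) (fun s : R => a (exp (s *: X)))
                  (left_field X a (a (exp (t *: X))))].

Definition killing_form (X Y : 'rV[R]_n) : R :=
  \tr (lin1_mx (fun Z => lie_bracket X (lie_bracket Y Z))).

Definition semisimple : Prop :=
  forall X, (forall Y, killing_form X Y = 0) -> X = 0.

Definition is_grading1 (g : int -> {vspace 'rV[R]_n}) : Prop :=
  [/\ forall i, 1 < `|i| -> g i = 0%VS,
      (g (-1)%R + g 0%R + g 1%R = fullv)%VS,
      directv (g (-1)%R + g 0%R + g 1%R)%VS &
      forall i j X Y,
        X \in g i -> Y \in g j -> lie_bracket X Y \in g (i + j)].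

End LieAlgebra.

Section Parabolic.
Context (R : realType) (n : nat) (G : lieGroupType R n).
Variables (exp : 'rV[R]_n -> G) (g : int -> {vspace 'rV[R]_n}) (P : set G).

(* The Lie algebra of a closed subgroup consists of the X whose one-parameter
   subgroup lies in it. *)
Definition is_parabolic : Prop :=
  [/\ closed P, P 1%g, (forall x y, P x -> P y -> P (x * y^-1)%g) &
      forall X, (forall t : R, P (exp (t *: X))) <-> X \in (g 0%R + g 1%R)%VS].

(* The point x P of G/P. *)
Definition left_coset (x : G) : set G := [set (x * p)%g | p in P].

Definition flow_curve (b : G) (X : 'rV[R]_n) (t : R) : set G :=
  left_coset (b * exp (t *: X))%g.

Definition is_geodesic_on (I : set R) (c : R -> set G) : Prop :=
  exists (b : G) (X : 'rV[R]_n),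
    X \in g (-1) /\ forall t, I t -> c t = flow_curve b X t.

End Parabolic.

Section Reparametrizations.
Context (R : realType).

Definition open_interval (I : set R) : Prop :=
  [/\ open I, is_interval I & I !=set0].

Definition is_reparametrization (I : set R) (phi : R -> R) : Prop :=
  smooth_on I phi /\ forall t, I t -> derive1 phi t != 0.

Definition mobius_num (M : 'M[R]_2) (t : R) : R := M 0 0 * t + M 0 1.
Definition mobius_den (M : 'M[R]_2) (t : R) : R := M 1 0 * t + M 1 1.
Definition mobius (M : 'M[R]_2) (t : R) : R := mobius_num M t / mobius_den M t.

End Reparametrizations.

(* Main.v *)
Require Import Defs.
From HB Require Import structures.
From mathcomp Require Import all_boot all_order all_algebra.
From mathcomp Require Import all_classical all_reals all_analysis.
From mathcomp Require Import ring lra.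

Set Implicit Arguments.
Unset Strict Implicit.
Unset Printing Implicit Defensive.

Import Order.TTheory GRing.Theory Num.Theory.
Import numFieldNormedType.Exports.

Local Open Scope classical_set_scope.
Local Open Scope ring_scope.

(** The geometry is read off in the Lie algebra through [Ad h], the
differential at 1 of the conjugation by h in the coordinates of the chart e.

Part (1). The two curves agree up to the parameter change phi exactly when
p(t) = exp(phi(t) X1)^-1 b exp(t X2) stays in P, where b = b1^-1 b2. Elements
of P preserve the subalgebra g_0 + g_1 under Ad, so t |-> Ad(p(t)) W stays in
g_0 + g_1 for every W in it. Its derivative does too; choosing W so that
Ad(p(t)) W is the grading element E, this derivative is
[Ad(p(t)) X2 - phi'(t) X1, E], and since bracketing with E detects degrees,
Ad(p(t)) X2 and phi'(t) X1 have the same component in g_{-1} ([tangency]).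
Here Ad(p(t)) X2 = Ad(exp(phi(t) X1))^-1 Y with Y = Ad(b) X2, which is
quadratic in phi(t) because ad X1 is nilpotent of order three:
  Y_{-1} - phi [X1, Y_0] + phi^2/2 [X1, [X1, Y_1]] = phi' X1.
As phi takes three distinct values, all three coefficients are multiples of
X1, and phi solves a Riccati equation phi' = al + be phi + ga phi^2
([riccati_coefficients]). Finally ad Y is nilpotent of order three, like
ad X2, and the graded components of (ad Y)^3 X1 = 0 force the discriminant
be^2 - 4 al ga to vanish ([quadratic_discriminant]); the solutions of such an
equation are linear fractional ([riccati_mobius]).

Part (2). If the parameter change t / (1 + t) yields a geodesic, its Riccati
equation is phi' = (1 - phi)^2, so ga = 1 and half of Y_1 is the required Z.
Conversely, an element Z with [X, [X, Z]] = X can be corrected so that X, Z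
and H = [Z, X] form an sl2-triple ([sl2_triple]), and then
  exp(k Z) exp(u X) = exp(u/(1+ku) X) exp(ln(1+ku) H) exp(k/(1+ku) Z),
as for 2 x 2 matrices: both sides have the same left logarithmic derivative
in u ([sl2_curve]). The last two factors lie in P, so the geodesic
exp(k Z) exp(u X) P runs through the points exp(u/(1+ku) X) P, and every
linear fractional map takes this form around a base point
([flow_curve_mobius]).

The Lie theory behind this is obtained from a calculus of left logarithmic
derivatives: a curve in G is determined by its logarithmic derivative and one
value ([logder_uniq]), and the derivative of Ad along a curve through 1 is the
bracket ([is_derive_Ad_curve]). The latter is where the bracket, defined by
left invariant fields, meets conjugation, and it rests on the symmetry of the
second derivative of the multiplication ([schwarz]). That Ad preserves the
bracket and the Jacobi identity then follow by differentiation. The grading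
element exists because the Killing form is nondegenerate, which makes every
derivation inner ([derivation_inner]). *)

(** * Differential calculus along curves *)

Section Calculus.
Context {R : realType}.

Lemma near_eq_is_diff (V W : normedModType R) (f g : V -> W) x (df : V -> W) :
  (\forall y \near x, f y = g y) -> is_diff x f df -> is_diff x g df.
Proof.
move=> fg [fx dfE].
have lin : linear df by rewrite -dfE; exact: linearP.
pose dfL : {linear V -> W} := HB.pack df (GRing.isLinear.Build _ _ _ _ _ lin).
have dfC : continuous dfL by rewrite -[dfL : V -> W]/df -dfE; exact: diff_continuous.
have gE : g \o shift x = cst (g x) + dfL +o_ 0 id.
  apply/eqaddoP => eps eps0.
  have /diff_locally := fx; rewrite dfE => /eqaddoP /(_ eps eps0).
  rewrite -(nbhs_singleton fg) => H.
  have fg0 : \forall h \near 0, f (h + x) = g (h + x).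
    by move: fg; rewrite (near_shift 0)/=; apply: filterS => h; rewrite subr0.
  near=> h.
  have E : f (h + x) = g (h + x) by near: h.
  have : `|(f \o shift x - (cst (f x) + df)) h| <= eps * `|id h| by near: h.
  by rewrite -[(f \o shift x - _) h]/(f (h + x) - (f x + df h)) E.
have dgE := diff_unique dfC gE.
by apply: DiffDef => //; apply/diff_locallyP; rewrite dgE.
Unshelve. all: by end_near. Qed.

Lemma is_derive_comp_curve (V W : normedModType R) (f : V -> W) (df : V -> W)
    (c : R -> V) t v :
  is_diff (c t) f df -> is_derive t (1 : R) c v ->
  is_derive t (1 : R) (fun s => f (c s)) (df v).
Proof.
move=> [fx dfE] [cd cv].
have cD : differentiable c t by exact/derivable1_diffP.
have fcD : differentiable (f \o c) t by exact: differentiable_comp.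
apply: DeriveDef; first exact/derivable1_diffP.
rewrite -[LHS]/('D_1 (f \o c) t) deriveE // diff_comp //= dfE.
by rewrite -cv deriveE.
Qed.

Lemma is_derive_affine_line (V : normedModType R) (X v : V) t :
  is_derive t (1 : R) (fun s => s *: X + v) X.
Proof.
rewrite -[X in is_derive _ _ _ X]addr0; apply: is_deriveD.
apply: DeriveDef; first exact/derivable1_diffP.
by rewrite deriveE // diff_val scale1r.
Qed.

Lemma is_derive_diffE (W : normedModType R) (c : R -> W) t v :
  is_derive t (1 : R) c v -> differentiable c t /\ 'd c t 1 = v.
Proof.
move=> [cd cv]; have cD : differentiable c t by exact/derivable1_diffP.
by split; rewrite // -cv deriveE.
Qed.

Lemma is_derive_chain (W : normedModType R) (f : R -> W) (h : R -> R) t v h' :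
  is_derive (h t) (1 : R) f v -> is_derive t (1 : R) h h' ->
  is_derive t (1 : R) (fun s => f (h s)) (h' *: v).
Proof.
move=> /is_derive_diffE[fd fE] dh.
have := is_derive_comp_curve (c := h) (differentiableP fd) dh.
by rewrite -fE -linearZ /= [h'%:A]mulr1.
Qed.

Lemma is_derive_pair (V W : normedModType R) (c : R -> V) (d : R -> W) t v w :
  is_derive t (1 : R) c v -> is_derive t (1 : R) d w ->
  is_derive t (1 : R) (fun s => (c s, d s)) (v, w).
Proof.
move=> [cd cv] [dd dv].
have cD : differentiable c t by exact/derivable1_diffP.
have dD : differentiable d t by exact/derivable1_diffP.
have pD : differentiable (fun s => (c s, d s)) t by exact: differentiable_pair.
apply: DeriveDef; first exact/derivable1_diffP.
by rewrite deriveE // diff_pair //= -!deriveE // cv dv.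
Qed.

Lemma is_derive_scale n (a : R -> R) (c : R -> 'rV[R]_n) t a' v :
  is_derive t (1 : R) a a' -> is_derive t (1 : R) c v ->
  is_derive t (1 : R) (fun s => a s *: c s) (a' *: c t + a t *: v).
Proof.
move=> ad [cd cv].
have acij i j : is_derive t (1 : R) (fun s => (a s *: c s) i j)
    (a' * c t i j + a t * v i j).
  have cij : is_derive t (1 : R) (fun s => c s i j) (v i j).
    apply: DeriveDef; first by move/derivable_mxP : cd.
    by rewrite -cv derive_mx // mxE.
  under eq_fun do rewrite mxE.
  have H := @is_deriveM _ _ a (fun s => c s i j) t 1 a' (v i j) ad cij.
  by rewrite addrC (mulrC a'); exact: H.
have acd : derivable (fun s => a s *: c s) t 1.
  by apply/derivable_mxP => i j; exact: (@ex_derive _ _ _ _ _ _ _ (acij i j)).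
apply: DeriveDef => //; rewrite derive_mx //; apply/matrixP => i j; rewrite !mxE.
exact: (@derive_val _ _ _ _ _ _ _ (acij i j)).
Qed.

Lemma is_derive_inv_fun (f : R -> R) f' t : is_derive t (1 : R) f f' -> f t != 0 ->
  is_derive t (1 : R) (fun s => (f s)^-1) (- (f t) ^- 2 * f').
Proof.
move=> [fd fv] ft0; apply: DeriveDef; first exact: derivableV.
by have := deriveV ft0 fd; rewrite fv.
Qed.

Lemma is_derive_mulc (f : R -> R) f' c t : is_derive t (1 : R) f f' ->
  is_derive t (1 : R) (fun s => c * f s) (c * f').
Proof. by move=> df; have := is_deriveZ c df. Qed.

Lemma derive0_cst_interval (f : R -> R) (I : set R) :
  is_interval I -> (forall t, I t -> is_derive t (1 : R) f 0) ->
  forall s t, I s -> I t -> f s = f t.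
Proof.
move=> itv df.
suff H s t : I s -> I t -> s < t -> f s = f t.
  move=> s t Is It; case: (ltgtP s t) => [|ts|->//]; first exact: H.
  by apply/esym/H.
move=> Is It st; apply/eqP; rewrite eq_sym -subr_eq0.
have Iin x : x \in `[s, t]%R -> I x.
  by rewrite in_itv/= => /andP[sx xt]; apply: (itv s t) => //; rewrite sx xt.
have fc : {within `[s, t], continuous f}.
  apply: derivable_within_continuous => x xst.
  exact: (@ex_derive _ _ _ _ _ _ _ (df x (Iin x xst))).
have fd x : x \in `]s, t[%R -> is_derive x (1 : R) f ((cst 0 : R -> R) x).
  move=> xst; apply: df; apply: Iin.
  by move: xst; rewrite !in_itv/= => /andP[/ltW -> /ltW ->].
have [c _ E] := @MVT_segment R f (cst 0) s t (ltW st) fd fc.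
by rewrite E mul0r.
Qed.

Lemma is_derive_coord m n (c : R -> 'M[R]_(m, n)) t v i j :
  is_derive t (1 : R) c v -> is_derive t (1 : R) (fun s => c s i j) (v i j).
Proof.
move=> [cd <-]; apply: DeriveDef; first by move/derivable_mxP : cd.
by rewrite derive_mx // mxE.
Qed.

Lemma derive0_cst_interval_mx m n (f : R -> 'M[R]_(m, n)) (I : set R) :
  is_interval I -> (forall t, I t -> is_derive t (1 : R) f 0) ->
  forall s t, I s -> I t -> f s = f t.
Proof.
move=> itv df s t Is It; apply/matrixP => i j.
apply: (derive0_cst_interval (f := fun s => f s i j) itv) => // x Ix.
by have := is_derive_coord i j (df x Ix); rewrite mxE.
Qed.

Lemma derive_neq0_inj (I : set R) (phi phi' : R -> R) :
  is_interval I -> (forall t, I t -> is_derive t (1 : R) phi (phi' t)) ->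
  (forall t, I t -> phi' t != 0) -> forall s t, I s -> I t -> s < t -> phi s != phi t.
Proof.
move=> itv dphi phi0 s t Is It st.
have Iin x : x \in `[s, t]%R -> I x.
  by rewrite in_itv/= => /andP[sx xt]; apply: (itv s t) => //; rewrite sx xt.
have fc : {within `[s, t], continuous phi}.
  apply: derivable_within_continuous => x xst.
  exact: (@ex_derive _ _ _ _ _ _ _ (dphi x (Iin x xst))).
have fd x : x \in `]s, t[%R -> is_derive x (1 : R) phi (phi' x).
  move=> xst; apply: dphi; apply: Iin.
  by move: xst; rewrite !in_itv/= => /andP[/ltW -> /ltW ->].
have [c cst E] := @MVT R phi phi' s t st fd fc.
have Ic : I c.
  by apply: Iin; move: cst; rewrite !in_itv/= => /andP[/ltW -> /ltW ->].
rewrite eq_sym -subr_eq0 E; apply: mulf_neq0; first exact: phi0.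
by rewrite subr_eq0 gt_eqF.
Qed.

End Calculus.

Lemma near_affine_line {R : realType} {V : normedModType R} (v x : V) (P : set V) :
  (\forall y \near x, P y) -> \forall s \near (0 : R), P (s *: v + x).
Proof.
have : s *: v + x @[s --> (0 : R)] --> x.
  rewrite -[X in _ --> X]add0r -[in X in _ --> X](scale0r v).
  by apply: cvgD; [apply: cvgZr_tmp; exact: cvg_id|exact: cvg_cst].
by apply.
Qed.

Lemma is_derive_unique {R : realType} {W : normedModType R} (c : R -> W) t v w :
  is_derive t (1 : R) c v -> is_derive t (1 : R) c w -> v = w.
Proof. by move=> [_ <-] [_ <-]. Qed.

Lemma is_derive_sum_scale {R : realType} {n m} (a : 'I_n -> R -> R) (a' : 'I_n -> R)
    (c : 'I_n -> R -> 'rV[R]_m) (c' : 'I_n -> 'rV[R]_m) t :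
  (forall k, is_derive t (1 : R) (a k) (a' k)) ->
  (forall k, is_derive t (1 : R) (c k) (c' k)) ->
  is_derive t (1 : R) (fun s => \sum_k a k s *: c k s)
    (\sum_k (a' k *: c k t + a k t *: c' k)).
Proof.
move=> da dc.
have := @is_derive_sum _ _ _ n (fun k s => a k s *: c k s) t 1 _
  (fun k => is_derive_scale (da k) (dc k)).
have -> : (\sum_(k < n) (fun s => a k s *: c k s)) = (fun s => \sum_k a k s *: c k s).
  by apply/funext => s; rewrite fct_sumE.
by [].
Qed.

Lemma is_derive_linear {R : realType} {n m} (f : 'rV[R]_n -> 'rV[R]_m)
    (c : R -> 'rV[R]_n) t v : linear f ->
  is_derive t (1 : R) c v -> is_derive t (1 : R) (fun s => f (c s)) (f v).
Proof.
move=> lin dc.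
pose L : {linear _ -> _} := HB.pack f (GRing.isLinear.Build _ _ _ _ _ lin).
have LE w : f w = \sum_k w 0 k *: f (delta_mx 0 k).
  rewrite {1}(row_sum_delta w) -[f]/(L : _ -> _) linear_sum.
  by apply: eq_bigr => k _; rewrite linearZ.
have := is_derive_sum_scale (fun k => is_derive_coord 0 k dc)
  (fun k => is_derive_cst (f (delta_mx 0 k)) t (1 : R)).
under eq_fun do rewrite -LE.
move=> H; apply: is_derive_eq H _.
by rewrite [RHS]LE; apply: eq_bigr => k _; rewrite scaler0 addr0.
Qed.

Lemma is_derive_bilinear {R : realType} {n m p} (f : 'rV[R]_n -> 'rV[R]_m -> 'rV[R]_p)
    (c : R -> 'rV[R]_n) (d : R -> 'rV[R]_m) t v w :
  (forall y, linear (f^~ y)) -> (forall x, linear (f x)) ->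
  is_derive t (1 : R) c v -> is_derive t (1 : R) d w ->
  is_derive t (1 : R) (fun s => f (c s) (d s)) (f v (d t) + f (c t) w).
Proof.
move=> linl linr dc dd.
have fE u z : f u z = \sum_k u 0 k *: f (delta_mx 0 k) z.
  pose L : {linear _ -> _} := HB.pack (f^~ z) (GRing.isLinear.Build _ _ _ _ _ (linl z)).
  rewrite {1}(row_sum_delta u) -[LHS]/(L _) linear_sum.
  by apply: eq_bigr => k _; rewrite linearZ.
have := is_derive_sum_scale (fun k => is_derive_coord 0 k dc)
  (fun k => is_derive_linear (linr (delta_mx 0 k)) dd).
under eq_fun do rewrite -fE.
by move=> H; apply: is_derive_eq H _; rewrite big_split /= -!fE.
Qed.

(** * Symmetry of second derivatives *)

Section Schwarz.
Context {R : realType} {V : normedModType R}.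
Variables (F : V -> R) (o : V).
Hypothesis Fdiff : \forall x \near o, differentiable F x.

Let Delta X Y (h : R) :=
  F (h *: X + h *: Y + o) - F (h *: X + o) - F (h *: Y + o) + F o.

(** The mean value theorem applied to s |-> F (s X + h Y + o) - F (s X + o)
turns the second difference into an increment of x |-> 'd F x X,
which the differentiability of that map at o estimates. *)
Let second_difference X Y : differentiable (fun x => 'd F x X) o ->
  forall eps, 0 < eps -> exists2 d : R, 0 < d & forall h, 0 < h < d ->
    `|Delta X Y h - h ^+ 2 * 'd (fun x => 'd F x X) o Y| <= eps * h ^+ 2.
Proof.
move=> dX eps eps0.
set L := 'd (fun x => 'd F x X) o.
(* h C bounds the sum of the norms of c X + h Y and c X for 0 <= c <= h. *)
pose C := 2 * `|X| + `|Y| + 1.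
have C0 : 0 < C by rewrite /C ltr_wpDl // addr_ge0 // mulr_ge0.
have eC0 : 0 < eps / C by rewrite divr_gt0.
have /diff_locally/eqaddoP/(_ _ eC0) rem := dX.
have Fd0 : \forall u \near (0 : V), differentiable F (u + o).
  by move: Fdiff; rewrite (near_shift 0)/=; apply: filterS => h; rewrite subr0.
have [d /= d0 Hd] := (nbhs_ballP _ _).1 (@filterI _ (nbhs (0 : V)) _ _ _ rem Fd0).
exists (d / C); first exact: divr_gt0.
move=> h /andP[h0 hd].
have small s k : 0 <= s <= h -> 0 <= k <= h -> `|s *: X + k *: Y| < d /\
    `|s *: X + k *: Y| <= h * (`|X| + `|Y|).
  move=> /andP[s0 sh] /andP[k0 kh].
  have H : `|s *: X + k *: Y| <= h * (`|X| + `|Y|).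
    rewrite (le_trans (ler_normD _ _))// !normrZ mulrDr !ger0_norm//.
    by rewrite lerD // ler_wpM2r.
  split => //; apply: (le_lt_trans H).
  move: hd; rewrite ltr_pdivlMr //; apply: le_lt_trans.
  rewrite ler_pM2l // /C; have := normr_ge0 X; lra.
have inball u : `|u| < d -> ball (0 : V) d u.
  by rewrite -ball_normE /ball_/= sub0r normrN.
pose g s := F (s *: X + h *: Y + o) - F (s *: X + o).
have dcurve k s : 0 <= s <= h -> 0 <= k <= h ->
   is_derive s (1 : R) (fun s => F (s *: X + k *: Y + o)) ('d F (s *: X + k *: Y + o) X).
  move=> sh kh; have [/inball/Hd[_ /= Fu] _] := small _ _ sh kh.
  apply: (is_derive_comp_curve (c := fun s => s *: X + k *: Y + o)).
    exact: DiffDef.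
  by under eq_fun do rewrite -addrA; exact: is_derive_affine_line.
have h00 : 0 <= h <= h by rewrite lexx ltW.
have z00 : 0 <= (0 : R) <= h by rewrite lexx ltW.
have dg s : 0 <= s <= h -> is_derive s (1 : R) g
    ('d F (s *: X + h *: Y + o) X - 'd F (s *: X + o) X).
  move=> sh; apply: is_deriveB; first exact: dcurve.
  by have := dcurve 0 s sh z00; under eq_fun do rewrite scale0r addr0; rewrite scale0r addr0.
pose g' s := 'd F (s *: X + h *: Y + o) X - 'd F (s *: X + o) X.
have gd x : x \in `]0, h[%R -> is_derive x (1 : R) g (g' x).
  by move=> /[!in_itv]/= /andP[/ltW x0 /ltW xh]; apply: dg; rewrite x0.
have gc : {within `[0, h], continuous g}.
  apply: derivable_within_continuous => x /[!in_itv]/= xh.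
  exact: (@ex_derive _ _ _ _ _ _ _ (dg x xh)).
have [c ch gE] := @MVT R g g' 0 h h0 gd gc.
have {}ch : 0 <= c <= h by move: ch; rewrite in_itv/= => /andP[/ltW -> /ltW ->].
have DE : Delta X Y h = g h - g 0.
  by rewrite /Delta /g !scale0r !add0r; ring.
rewrite DE gE subr0.
have [s1 s2] := small _ _ ch h00; have [s3 s4] := small _ _ ch z00.
have LE p q : L (p *: X + q *: Y) = p * L X + q * L Y by rewrite linearD !linearZ.
have key u : `|u| < d -> `|'d F (u + o) X - ('d F o X + L u)| <= eps / C * `|u|.
  by move=> /inball/Hd[].
rewrite scale0r addr0 in s3 s4.
have r1 := key _ s1; rewrite LE in r1.
have r2 := key _ s3; rewrite linearZ in r2.
rewrite /g'; move: ('d F (c *: X + h *: Y + o) X) ('d F (c *: X + o) X) r1 r2.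
move: ('d F o X) (L X) (L Y) => D LX LY A B r1 r2.
have -> : (A - B) * h - h ^+ 2 * LY =
  h * ((A - (D + (c * LX + h * LY))) - (B - (D + c * LX))) by ring.
rewrite normrM gtr0_norm // expr2 mulrCA ler_pM2l //.
rewrite (le_trans (ler_normB _ _))// (le_trans (lerD r1 r2))//.
have s4' : `|c *: X| <= h * `|X|.
  by rewrite normrZ; move/andP: ch => [? ?]; rewrite ger0_norm // ler_wpM2r.
rewrite -mulrDr -mulrA ler_pM2l // mulrC ler_pdivrMr //.
rewrite (le_trans (lerD s2 s4'))// /C -subr_ge0.
have -> : h * (2 * `|X| + `|Y| + 1) - (h * (`|X| + `|Y|) + h * `|X|) = h by ring.
exact: ltW.
Qed.

(** The second difference is symmetric in X and Y, and both iterated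
derivatives are its limit after division by h^2. *)
Lemma schwarz X Y :
  differentiable (fun x => 'd F x X) o -> differentiable (fun x => 'd F x Y) o ->
  'd (fun x => 'd F x X) o Y = 'd (fun x => 'd F x Y) o X.
Proof.
move=> dX dY; apply/eqP; rewrite -subr_eq0 -normr_eq0; apply/eqP.
apply/le_anti/andP; split => //; apply/ler_addgt0Pl => eps eps0; rewrite addr0.
have e20 : 0 < eps / 2 by rewrite divr_gt0.
have [d1 d10 H1] := second_difference Y dX e20.
have [d2 d20 H2] := second_difference X dY e20.
pose h := Num.min d1 d2 / 2.
have m0 : 0 < Num.min d1 d2 by rewrite lt_min d10.
have h0 : 0 < h by rewrite divr_gt0.
have hm : h < Num.min d1 d2 by rewrite /h; lra.
have := hm; rewrite lt_min => /andP[hd1 hd2].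
have {}H1 := H1 h (introT andP (conj h0 hd1)).
have {}H2 := H2 h (introT andP (conj h0 hd2)).
have DC : Delta Y X h = Delta X Y h.
  by rewrite /Delta (addrC (h *: Y)); ring.
rewrite DC in H2.
set a := 'd _ o Y in H1 *; set b := 'd _ o X in H2 *.
have h20 : 0 < h ^+ 2 by rewrite exprn_gt0.
rewrite -(ler_pM2r h20) -[X in _ * X](gtr0_norm h20) -normrM.
have -> : (a - b) * h ^+ 2 = (Delta X Y h - h ^+ 2 * b) - (Delta X Y h - h ^+ 2 * a) by ring.
rewrite (le_trans (ler_normB _ _))// (le_trans (lerD H2 H1))//.
by rewrite -mulrDl -splitr.
Qed.

End Schwarz.

Lemma is_diff_coord {R : realType} {V : normedModType R} {m n}
    (f : V -> 'M[R]_(m, n)) x i j :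
  differentiable f x ->
  is_diff x (fun y => f y i j) (fun v => 'd f x v i j).
Proof.
move=> fx.
have cx : differentiable (fun N : 'M[R]_(m, n) => N i j) (f x).
  exact: differentiable_coord.
have lin : linear (fun N : 'M[R]_(m, n) => N i j).
  by move=> a u v; rewrite !mxE.
pose cL : {linear 'M[R]_(m, n) -> R} :=
  HB.pack (fun N : 'M[R]_(m, n) => N i j) (GRing.isLinear.Build _ _ _ _ _ lin).
have cc : continuous cL by move=> N; exact: coord_continuous.
have [H1 H2] : is_diff x ((fun N : 'M[R]_(m, n) => N i j) \o f) (cL \o 'd f x).
  apply: is_diff_comp; first exact: DiffDef.
  by apply: DiffDef => //; rewrite -[LHS]/('d cL (f x) : _ -> _) diff_lin.
exact: DiffDef.
Qed.

Lemma schwarz_rV {R : realType} {V : normedModType R} {n}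
    (F : V -> 'rV[R]_n) (o X Y : V) :
  (\forall x \near o, differentiable F x) ->
  differentiable (fun x => 'd F x X) o -> differentiable (fun x => 'd F x Y) o ->
  'd (fun x => 'd F x X) o Y = 'd (fun x => 'd F x Y) o X.
Proof.
move=> Fd dX dY; apply/rowP => j.
have Fjd : \forall x \near o, is_diff x (fun y => F y 0 j) (fun v => 'd F x v 0 j).
  by apply: filterS Fd => x; exact: is_diff_coord.
have Fjd' : \forall x \near o, differentiable (fun y => F y 0 j) x.
  by apply: filterS Fjd => x [].
have cX Z : differentiable (fun x => 'd F x Z) o ->
    is_diff o (fun x => 'd (fun y => F y 0 j) x Z) (fun v => 'd (fun x => 'd F x Z) o v 0 j).
  move=> dZ; apply: near_eq_is_diff (is_diff_coord 0 j dZ).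
  by apply: filterS Fjd => x [_ ->].
have [d1 E1] := cX _ dX; have [d2 E2] := cX _ dY.
have := schwarz Fjd' d1 d2.
by rewrite E1 E2.
Qed.

(** * Graded Lie algebras *)

Ltac vec := by apply/rowP => ?; rewrite !mxE; ring.

Section LieAlgebra.
Context {R : realType} {n : nat}.
Local Notation V := 'rV[R]_n.
Variable br : V -> V -> V.
Hypotheses (brl : forall y, linear (br^~ y)) (brr : forall x, linear (br x)).
Hypothesis brC : forall x y, br x y = - br y x.
Hypothesis jac : forall x y z, br x (br y z) = br (br x y) z + br y (br x z).

Lemma brDl x y z : br (x + y) z = br x z + br y z.
Proof. by have := brl z 1 x y; rewrite !scale1r. Qed.

Lemma brDr x y z : br x (y + z) = br x y + br x z.
Proof. by have := brr x 1 y z; rewrite !scale1r. Qed.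

Lemma br0l y : br 0 y = 0.
Proof. by apply: (addrI (br 0 y)); rewrite -brDl !addr0. Qed.

Lemma br0r x : br x 0 = 0.
Proof. by rewrite brC br0l oppr0. Qed.

Lemma brZl a x y : br (a *: x) y = a *: br x y.
Proof. by have := brl y a x 0; rewrite addr0 br0l addr0. Qed.

Lemma brZr a x y : br x (a *: y) = a *: br x y.
Proof. by have := brr x a y 0; rewrite addr0 br0r addr0. Qed.

Lemma brNl x y : br (- x) y = - br x y.
Proof. by rewrite -scaleN1r brZl scaleN1r. Qed.

Lemma brNr x y : br x (- y) = - br x y.
Proof. by rewrite -scaleN1r brZr scaleN1r. Qed.

Lemma brBl x y z : br (x - y) z = br x z - br y z.
Proof. by rewrite brDl brNl. Qed.

Lemma brBr x y z : br x (y - z) = br x y - br x z.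
Proof. by rewrite brDr brNr. Qed.

Lemma brxx x : br x x = 0.
Proof.
have /eqP := brC x x; rewrite -addr_eq0 -mulr2n -scaler_nat scaler_eq0.
by rewrite pnatr_eq0 /= => /eqP.
Qed.

Variable g : int -> {vspace V}.
Hypothesis g_out : forall i, 1 < `|i| -> g i = 0%VS.
Hypothesis g_full : (g (-1)%R + g 0%R + g 1%R = fullv)%VS.
Hypothesis g_direct : directv (g (-1)%R + g 0%R + g 1%R)%VS.
Hypothesis g_br : forall i j X Y, X \in g i -> Y \in g j -> br X Y \in g (i + j).

Lemma grading_unique a b c a' b' c' :
  a \in g (-1) -> b \in g 0 -> c \in g 1 ->
  a' \in g (-1) -> b' \in g 0 -> c' \in g 1 ->
  a + b + c = a' + b' + c' -> [/\ a = a', b = b' & c = c'].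
Proof.
move=> ga gb gc ga' gb' gc' /eqP E.
have d1 := g_direct; rewrite directv_addE /= directv_addE /= in d1.
case/and3P: d1 => /and3P[_ _ /eqP/directv_addP d0] _ /eqP/directv_addP d01.
have := directv_add_unique d01 _ _ _ _ (memv_add ga gb) (memv_add ga' gb') gc gc'.
rewrite E => /esym/eqP[/eqP E' ->].
by have := directv_add_unique d0 _ _ _ _ ga ga' gb gb'; rewrite E' => /esym/eqP[-> ->].
Qed.

Definition pr1 : V -> V := addv_pi2 (g (-1) + g 0)%VS (g 1).
Definition prm : V -> V := addv_pi1 (g (-1)) (g 0) \o addv_pi1 (g (-1) + g 0)%VS (g 1).
Definition pr0 : V -> V := addv_pi2 (g (-1)) (g 0) \o addv_pi1 (g (-1) + g 0)%VS (g 1).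

Lemma prm_in v : prm v \in g (-1). Proof. exact: memv_pi1. Qed.
Lemma pr0_in v : pr0 v \in g 0. Proof. exact: memv_pi2. Qed.
Lemma pr1_in v : pr1 v \in g 1. Proof. exact: memv_pi2. Qed.
Hint Resolve prm_in pr0_in pr1_in : core.

Lemma pr_sum v : prm v + pr0 v + pr1 v = v.
Proof.
rewrite /prm /pr0 /pr1 /= addv_pi1_pi2 ?memv_pi1 // addv_pi1_pi2 //.
by rewrite g_full memvf.
Qed.

Lemma prm_linear : linear prm. Proof. by move=> a u v; rewrite /prm /= !linearP. Qed.
Lemma pr1_linear : linear pr1. Proof. by move=> a u v; rewrite /pr1 linearP. Qed.

Lemma prE a b c : a \in g (-1) -> b \in g 0 -> c \in g 1 ->
  [/\ prm (a + b + c) = a, pr0 (a + b + c) = b & pr1 (a + b + c) = c].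
Proof. by move=> ga gb gc; apply: grading_unique => //; exact: pr_sum. Qed.

Lemma prm_p v : (v \in g 0 + g 1)%VS = (prm v == 0).
Proof.
apply/idP/eqP => [/memv_addP[b gb [c gc ->]]|E].
  by have [] := prE (mem0v (g (-1))) gb gc; rewrite add0r.
by rewrite -(pr_sum v) E add0r memv_add.
Qed.

Lemma br_in i j k x y : x \in g i -> y \in g j -> i + j = k -> br x y \in g k.
Proof. by move=> gx gy <-; exact: g_br. Qed.

Lemma br_out i j x y : x \in g i -> y \in g j -> 1 < `|i + j| -> br x y = 0.
Proof. by move=> gx gy ij; have := g_br gx gy; rewrite g_out // memv0 => /eqP. Qed.

Lemma br_graded a b c a' b' c' :
  a \in g (-1) -> c \in g 1 -> a' \in g (-1) -> c' \in g 1 ->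
  br (a + b + c) (a' + b' + c') =
  (br a b' + br b a') + (br a c' + br b b' + br c a') + (br b c' + br c b').
Proof.
move=> ga gc ga' gc'; rewrite !(brDl, brDr) (br_out ga ga') // (br_out gc gc') //.
vec.
Qed.

Lemma nilpotent_gm x y : x \in g (-1) -> br x (br x (br x y)) = 0.
Proof.
move=> gx; rewrite -(pr_sum y) !brDr (br_out gx (prm_in y)) // !br0r add0r.
have h0 := g_br gx (pr0_in y); have h1 := g_br gx (pr1_in y).
rewrite (br_out gx h0) // br0r add0r.
by rewrite (br_out gx (g_br gx h1)).
Qed.

(** The derivation that multiplies g_i by i. *)
Lemma grading_derivation x y :
  let D z := pr1 z - prm z in D (br x y) = br (D x) y + br x (D y).
Proof.
move=> D.
have [mx0 x0 mx1] := And3 (prm_in x) (pr0_in x) (pr1_in x).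
have [my0 y0 my1] := And3 (prm_in y) (pr0_in y) (pr1_in y).
have DE : D (br x y) = br (pr0 x) (pr1 y) + br (pr1 x) (pr0 y)
    - (br (prm x) (pr0 y) + br (pr0 x) (prm y)).
  rewrite /D -{1 2}(pr_sum x) -{1 2}(pr_sum y) br_graded //.
  have [|||-> _ ->] // := @prE (br (prm x) (pr0 y) + br (pr0 x) (prm y))
     (br (prm x) (pr1 y) + br (pr0 x) (pr0 y) + br (pr1 x) (prm y))
     (br (pr0 x) (pr1 y) + br (pr1 x) (pr0 y)).
  - by rewrite memvD ?(br_in mx0 y0) ?(br_in x0 my0).
  - by rewrite !memvD ?(br_in mx0 my1) ?(br_in x0 y0) ?(br_in mx1 my0).
  - by rewrite memvD ?(br_in x0 my1) ?(br_in mx1 y0).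
have E1 : br (D x) y = br (- prm x + 0 + pr1 x) (prm y + pr0 y + pr1 y).
  by rewrite pr_sum; congr (br _ y); rewrite /D addr0 addrC.
have E2 : br x (D y) = br (prm x + pr0 x + pr1 x) (- prm y + 0 + pr1 y).
  by rewrite pr_sum; congr (br x _); rewrite /D addr0 addrC.
rewrite DE E1 E2 !br_graded ?memvN //; rewrite !(brNl, brNr, br0l, br0r).
vec.
Qed.

Definition ad_mx x : 'M[R]_n := lin1_mx (br x).

Lemma mul_ad_mx x v : v *m ad_mx x = br x v.
Proof.
pose L : {linear V -> V} := HB.pack (br x) (GRing.isLinear.Build _ _ _ _ _ (brr x)).
exact: (mul_rV_lin1 L).
Qed.

Lemma row_mul_inj (A B : 'M[R]_n) : (forall v : V, v *m A = v *m B) -> A = B.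
Proof. by move=> AB; apply/row_matrixP => i; rewrite !rowE AB. Qed.

Lemma ad_mx_br x y : ad_mx (br x y) = ad_mx y *m ad_mx x - ad_mx x *m ad_mx y.
Proof.
apply: row_mul_inj => v; rewrite mulmxBr !mulmxA !mul_ad_mx.
by rewrite jac addrK.
Qed.

Lemma ad_mx_linear : linear ad_mx.
Proof.
by move=> a x y; apply: row_mul_inj => v; rewrite mulmxDr -scalemxAr !mul_ad_mx brDl brZl.
Qed.

(** The Killing form, written with matrices acting on row vectors, whence the
reversed order of the factors. *)
Definition trace_form x y : R := \tr (ad_mx y *m ad_mx x).
Hypothesis nondeg : forall x, (forall y, trace_form x y = 0) -> x = 0.

(** The Gram matrix of a nondegenerate form is invertible. *)
Lemma trace_form_represents (f : V -> R) : (forall a x y, f (a *: x + y) = a * f x + f y) ->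
  exists x, forall y, trace_form x y = f y.
Proof.
move=> flin.
pose k : 'M[R]_n := \matrix_(i, j) trace_form (delta_mx 0 i) (delta_mx 0 j).
have killl y : linear ((fun x => trace_form x y) : V -> R^o).
  by move=> a u v; rewrite /trace_form ad_mx_linear mulmxDr -scalemxAr linearP.
have killr x : linear (trace_form x : V -> R^o).
  by move=> a u v; rewrite /trace_form ad_mx_linear mulmxDl -scalemxAl linearP.
have linE (h : V -> R^o) : linear h -> forall x, h x = \sum_i x 0 i * h (delta_mx 0 i).
  move=> lh x; pose L : {linear V -> R^o} := HB.pack h (GRing.isLinear.Build _ _ _ _ _ lh).
  rewrite -[h]/(L : _ -> _) {1}(row_sum_delta x) linear_sum.
  by apply: eq_bigr => i _; rewrite linearZ.
have kE x j : (x *m k) 0 j = trace_form x (delta_mx 0 j).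
  rewrite mxE (linE _ (killl _)); apply: eq_bigr => i _; by rewrite !mxE.
have ku : k \in unitmx.
  rewrite -row_free_unit -kermx_eq0; apply/eqP/row_matrixP => i; rewrite row0.
  set x := row i _; apply: nondeg => y.
  have xk : x *m k = 0 by apply/sub_kermxP; exact: row_sub.
  rewrite (linE _ (killr x)) big1 // => j _.
  by rewrite -kE xk mxE mulr0.
pose fr : V := \row_j f (delta_mx 0 j).
exists (fr *m invmx k) => y.
rewrite (linE _ (killr _)) (linE f) //; apply: eq_bigr => j _.
by rewrite -kE mulmxKV // mxE.
Qed.

(** Represent the functional y |-> tr(ad y o D) as the Killing form with some
E. Then D' = D - ad E satisfies tr(ad z o D') = 0 for all z, hence the
Killing form of D' x and y, which is the trace of D' composed with
ad [y, x], vanishes. *)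
Lemma derivation_inner (D : V -> V) : linear D ->
  (forall x y, D (br x y) = br (D x) y + br x (D y)) ->
  exists E, forall x, br E x = D x.
Proof.
move=> Dlin Dder.
pose DL : {linear V -> V} := HB.pack D (GRing.isLinear.Build _ _ _ _ _ Dlin).
pose Dm : 'M[R]_n := lin1_mx D.
have mulD v : v *m Dm = D v by exact: (mul_rV_lin1 DL).
have [|E HE] := @trace_form_represents (fun y => \tr (ad_mx y *m Dm)).
  by move=> a x y; rewrite ad_mx_linear mulmxDl -scalemxAl linearP.
exists E => x; apply/eqP; rewrite -subr_eq0; apply/eqP; apply: nondeg => y.
pose D' := Dm - ad_mx E.
have trD' z : \tr (ad_mx z *m D') = 0.
  by rewrite /D' mulmxBr linearB /= -HE /trace_form subrr.
have mulD' v : v *m D' = D v - br E v by rewrite /D' mulmxBr mulD mul_ad_mx.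
have admD' : ad_mx (br E x - D x) = D' *m ad_mx x - ad_mx x *m D'.
  apply: row_mul_inj => v; rewrite mulmxBr !mulmxA !mulD' !mul_ad_mx.
  by rewrite brBl brBr Dder (jac E x v); vec.
rewrite /trace_form admD' mulmxBr linearB /= !mulmxA.
rewrite [X in X - _]mxtrace_mulC mulmxA -linearB /= -mulmxBl.
by rewrite -ad_mx_br trD'.
Qed.

(** E is in degree 0 since the grading derivation kills it: [E, E] = 0. *)
Lemma grading_element : exists2 E, E \in g 0 & forall x, br E x = pr1 x - prm x.
Proof.
have [|E HE] := @derivation_inner (fun z => pr1 z - prm z) _ grading_derivation.
  by move=> a u v; rewrite pr1_linear prm_linear; vec.
exists E => //.
have E0 : prm E + 0 + 0 = 0 + 0 + pr1 E.
  by have := HE E; rewrite brxx => /esym/eqP; rewrite subr_eq0 => /eqP ->; vec.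
have [Em _ E1] := grading_unique (prm_in E) (mem0v _) (mem0v _)
  (mem0v _) (mem0v _) (pr1_in E) E0.
by rewrite -(pr_sum E) Em -E1 add0r addr0.
Qed.
(** On the line of X, the element Y acts as the vector field q(s) d/ds with
q(s) = al + be s + ga s^2, its value at s X being the component in g_{-1} of
exp(- s ad X) Y, and brackets correspond to brackets of vector fields.
Applying ad (q d/ds) three times to d/ds gives the discriminant of q times q'
(up to sign). The two coefficients of q' account for the two equations
obtained below, in degrees -1 and 0. *)
Lemma quadratic_discriminant X Y al be ga : X \in g (-1) -> X != 0 ->
  prm Y = al *: X -> br X (pr0 Y) = - be *: X ->
  br X (br X (pr1 Y)) = (2 * ga) *: X ->
  br Y (br Y (br Y X)) = 0 -> be ^+ 2 = 4 * al * ga.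
Proof.
move=> gX X0 Ym Y0 Y1 nilp.
have g0 := pr0_in Y; have g1 := pr1_in Y.
set y0 := pr0 Y in Y0 g0 *; set y1 := pr1 Y in Y1 g1 *.
have YE : Y = al *: X + y0 + y1 by rewrite -Ym pr_sum.
have Y0' : br y0 X = be *: X by rewrite brC Y0 scaleNr opprK.
pose K := br y1 X; have gK : K \in g 0 by apply: br_in g1 gX _.
have XK : br X K = (- 2 * ga) *: X by rewrite /K (brC y1) brNr Y1 -scaleNr mulNr.
pose s0 := br y0 K + be *: K; pose s1 := br y1 K.
pose c2 := be ^+ 2 - 2 * al * ga.
have gs0 : s0 \in g 0 by rewrite memvD ?memvZ ?(br_in g0 gK).
have gs1 : s1 \in g 1 by exact: br_in g1 gK _.
have galX : al *: X \in g (-1) by exact: memvZ.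
have u1 : br Y X = be *: X + K + 0.
  have -> : br Y X = br (al *: X + y0 + y1) (X + 0 + 0) by rewrite YE !addr0.
  by rewrite br_graded ?mem0v // !br0r Y0' -/K; vec.
have u2 : br Y (br Y X) = c2 *: X + s0 + s1.
  rewrite u1 YE br_graded ?memvZ ?mem0v // !br0r !brZr !brZl XK Y0' -/K -/s1.
  by rewrite /c2 /s0; vec.
pose a := al *: br X s0 + c2 *: br y0 X.
pose b := al *: br X s1 + br y0 s0 + c2 *: K.
have u3 : a + b + (br y0 s1 + br y1 s0) = 0 + 0 + 0.
  rewrite !addr0 -nilp u2 YE br_graded ?memvZ // !brZl !brZr -/K.
  by rewrite /a /b; vec.
have ga' : a \in g (-1) by rewrite memvD ?memvZ ?(br_in gX gs0) ?(br_in g0 gX).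
have gb' : b \in g 0 by rewrite !memvD ?memvZ ?(br_in gX gs1) ?(br_in g0 gs0).
have gc' : br y0 s1 + br y1 s0 \in g 1 by rewrite memvD ?(br_in g0 gs1) ?(br_in g1 gs0).
have [a0 b0 _] := grading_unique ga' gb' gc' (mem0v _) (mem0v _) (mem0v _) u3.
have X0K : br X (br y0 K) = 0.
  by rewrite jac Y0 XK brZl brZr XK Y0'; vec.
have Xs0 : br X s0 = (- 2 * be * ga) *: X.
  by rewrite /s0 brDr X0K brZr XK; vec.
have Ea : (be * (be ^+ 2 - 4 * al * ga)) *: X = 0.
  by rewrite -a0 /a Xs0 Y0' /c2; vec.
have XXs1 : br X (br X s1) = (4 * ga ^+ 2) *: X.
  have -> : br X s1 = (- 2 * ga) *: K.
    by rewrite /s1 jac (brC X y1) -/K brNl brxx XK brZr -/K; vec.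
  by rewrite brZr XK; vec.
have Xys : br X (br y0 s0) = 0.
  have X00 : br X (br y0 (br y0 K)) = 0.
    by rewrite jac X0K br0r addr0 Y0 brZl X0K scaler0.
  by rewrite /s0 brDr brDr X00 brZr brZr X0K scaler0 addr0.
(* The equation b = 0 in degree 0, bracketed with X, lands on the line of X. *)
have Eb : (ga * (be ^+ 2 - 4 * al * ga)) *: X = 0.
  have : br X b = 0 by rewrite b0 br0r.
  rewrite /b 2!brDr 2!brZr XXs1 Xys XK => E.
  have -> : (ga * (be ^+ 2 - 4 * al * ga)) *: X = (- 2^-1) *: 0.
    by rewrite -E /c2; apply/rowP => j; rewrite !mxE; field.
  by rewrite scaler0.
move/eqP: Ea; rewrite scaler_eq0 (negbTE X0) orbF mulf_eq0 subr_eq0 => /orP[/eqP be0|/eqP//].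
move/eqP: Eb; rewrite scaler_eq0 (negbTE X0) orbF mulf_eq0 subr_eq0 => /orP[/eqP ga0|/eqP//].
by rewrite be0 ga0 mulr0 expr0n.
Qed.

Lemma prm_quadratic X Y s : X \in g (-1) ->
  prm (Y - s *: br X Y + (s ^+ 2 / 2) *: br X (br X Y)) =
  prm Y - s *: br X (pr0 Y) + (s ^+ 2 / 2) *: br X (br X (pr1 Y)).
Proof.
move=> gX.
have h0 := br_in gX (pr0_in Y) (erefl : -1 + 0 = -1 :> int).
have h1 := br_in gX (pr1_in Y) (erefl : -1 + 1 = 0 :> int).
have h11 := br_in gX h1 (erefl : -1 + 0 = -1 :> int).
have E1 : br X Y = br X (pr0 Y) + br X (pr1 Y).
  by rewrite -{1}(pr_sum Y) !brDr (br_out gX (prm_in Y)) // add0r.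
have E2 : br X (br X Y) = br X (br X (pr1 Y)).
  by rewrite E1 brDr (br_out gX h0) // add0r.
rewrite E2 E1 -{1}(pr_sum Y).
have [<- _ _] := prE (a := prm Y - s *: br X (pr0 Y) + (s ^+ 2 / 2) *: br X (br X (pr1 Y)))
  (b := pr0 Y - s *: br X (pr1 Y)) (c := pr1 Y)
  (memvD (memvB (prm_in Y) (memvZ _ h0)) (memvZ _ h11))
  (memvB (pr0_in Y) (memvZ _ h1)) (pr1_in Y).
by congr prm; vec.
Qed.

(** With Z2 = - 2 Z and H = [Z2, X] one has [H, X] = - 2 X, but [H, Z2] may
differ from 2 Z2. The defect is a multiple of W = [H, Z2]/2 - Z2, which
commutes with X; as g_1 is abelian, [H, W] = [[Z2, X], W] = 0, so replacing
Z2 by Z2 + W corrects it. *)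
Lemma sl2_triple X Z : X \in g (-1) -> Z \in g 1 -> br X (br X Z) = X ->
  exists H Z', [/\ H \in g 0, Z' \in g 1, br Z' X = H, br H X = - 2 *: X &
    br H Z' = 2 *: Z'].
Proof.
move=> gX gZ XXZ.
pose Z2 := - 2 *: Z; pose H := br Z2 X; pose Z' := 2^-1 *: br H Z2.
have gZ2 : Z2 \in g 1 by exact: memvZ.
have gH : H \in g 0 by exact: br_in gZ2 gX _.
have gZ' : Z' \in g 1 by rewrite memvZ // (br_in gH gZ2).
have HX : br H X = - 2 *: X.
  by rewrite brC /H (brC Z2) brNr opprK /Z2 !brZr XXZ.
have Z'X : br Z' X = H.
  have := jac X H Z2; rewrite (brC X H) HX (brC X Z2) -/H brNr brxx oppr0 addr0.
  rewrite -scaleNr opprK brZl (brC X Z2) -/H => E.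
  by rewrite /Z' brZl brC E -scalerN opprK scalerA mulVf ?scale1r // pnatr_eq0.
exists H, Z'; split => //.
pose W := Z' - Z2.
have gW : W \in g 1 by rewrite memvB.
have WX : br W X = 0 by rewrite brBl Z'X subrr.
have HW : br H W = 0.
  have := jac Z2 X W; rewrite (brC X W) WX oppr0 br0r -/H (br_out gZ2 gW) // br0r addr0.
  by move=> <-.
have : br H Z' = br H Z2 by apply/eqP; rewrite -subr_eq0 -brBr HW.
by move=> ->; rewrite /Z' scalerA mulfV ?scale1r // pnatr_eq0.
Qed.

(** Divided differences express the coefficients through three values. *)
Lemma quadratic_in_subspace (U : {vspace V}) (v0 v1 v2 : V) (x1 x2 x3 : R) :
  x1 != x2 -> x1 != x3 -> x2 != x3 ->
  (forall x, x \in [:: x1; x2; x3] -> v0 + x *: v1 + x ^+ 2 *: v2 \in U) ->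
  [/\ v0 \in U, v1 \in U & v2 \in U].
Proof.
move=> n12 n13 n23 H.
have [h1 h2 h3] : [/\ v0 + x1 *: v1 + x1 ^+ 2 *: v2 \in U,
   v0 + x2 *: v1 + x2 ^+ 2 *: v2 \in U & v0 + x3 *: v1 + x3 ^+ 2 *: v2 \in U].
  by split; apply: H; rewrite !inE eqxx ?orbT.
have d12 : x1 - x2 != 0 by rewrite subr_eq0.
have d13 : x1 - x3 != 0 by rewrite subr_eq0.
have d23 : x2 - x3 != 0 by rewrite subr_eq0.
have v2E : v2 = ((x1 - x2) * (x1 - x3))^-1 *: (v0 + x1 *: v1 + x1 ^+ 2 *: v2)
  - ((x1 - x2) * (x2 - x3))^-1 *: (v0 + x2 *: v1 + x2 ^+ 2 *: v2)
  + ((x1 - x3) * (x2 - x3))^-1 *: (v0 + x3 *: v1 + x3 ^+ 2 *: v2).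
  by apply/rowP => j; rewrite !mxE; field; rewrite d12 d13 d23.
have U2 : v2 \in U by rewrite v2E memvD ?memvB ?memvZ.
have v1E : v1 = (x1 - x2)^-1 *: ((v0 + x1 *: v1 + x1 ^+ 2 *: v2)
    - (v0 + x2 *: v1 + x2 ^+ 2 *: v2)) - (x1 + x2) *: v2.
  by apply/rowP => j; rewrite !mxE; field.
have U1 : v1 \in U by rewrite v1E memvB ?memvZ ?memvB.
split => //.
have -> : v0 = (v0 + x1 *: v1 + x1 ^+ 2 *: v2) - x1 *: v1 - x1 ^+ 2 *: v2 by vec.
by rewrite !memvB ?memvZ.
Qed.
End LieAlgebra.

(** * Charts *)

Section Charts.
Context {R : realType} {n : nat} {T : topologicalType}.
Variable a : chart R n T.

Lemma chart_im_map x : chart_dom a x -> chart_im a (a x).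
Proof. by move=> dx; exists x. Qed.

Lemma chart_invK_dom x : chart_dom a x -> chart_inv a (a x) = x.
Proof. by move=> dx; apply: chart_mapK; rewrite inE. Qed.

Lemma chart_inv_dom y : chart_im a y -> chart_dom a (chart_inv a y).
Proof. by move=> [x dx <-]; rewrite chart_invK_dom. Qed.

Lemma chart_mapK_im y : chart_im a y -> a (chart_inv a y) = y.
Proof. by move=> [x dx <-]; rewrite chart_invK_dom. Qed.

Lemma near_chart_dom x : chart_dom a x -> \forall y \near x, chart_dom a y.
Proof. by move=> dx; apply: open_nbhs_nbhs; split; first exact: chart_dom_open. Qed.

Lemma near_chart_im x : chart_dom a x -> \forall y \near a x, chart_im a y.
Proof.
move=> dx; apply: open_nbhs_nbhs; split; first exact: chart_im_open.
exact: chart_im_map.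
Qed.

Lemma chart_inv_cvg x : chart_dom a x -> chart_inv a y @[y --> a x] --> x.
Proof.
by move=> dx; rewrite -[X in _ --> X](chart_invK_dom dx);
  apply: chart_inv_continuous; exact: chart_im_map.
Qed.

End Charts.

(** * Lie groups: logarithmic derivatives, adjoint action, exponential *)

Section LieGroup.
Context {R : realType} {n : nat} {G : lieGroupType R n}.
Implicit Types (a b c : chart R n G) (g h : G) (p q : R -> G).

Lemma mulg_cvg {T : Type} {F : set_system T} {FF : Filter F} (f k : T -> G) x y :
  f t @[t --> F] --> x -> k t @[t --> F] --> y ->
  (f t * k t)%g @[t --> F] --> (x * y)%g.
Proof.
move=> fx ky; apply: (@cvg_comp _ _ _ (fun t => (f t, k t)) (fun p : G * G => (p.1 * p.2)%g)).
  exact: (cvg_pair fx ky).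
exact: (@lie_mul_continuous _ _ G (x, y)).
Qed.

Lemma invg_cvg {T : Type} {F : set_system T} {FF : Filter F} (f : T -> G) x :
  f t @[t --> F] --> x -> (f t)^-1%g @[t --> F] --> (x^-1)%g.
Proof. by move=> fx; apply: (cvg_comp _ _ fx); exact: lie_inv_continuous. Qed.

Lemma near_cvg_dom {T : Type} {F : set_system T} {FF : Filter F} a (f : T -> G) g :
  f t @[t --> F] --> g -> chart_dom a g -> \forall t \near F, chart_dom a (f t).
Proof. by move=> fg dg; apply: fg; exact: near_chart_dom. Qed.

Definition chart_mul a b c (u : 'rV[R]_n * 'rV[R]_n) : 'rV[R]_n :=
  c (chart_inv a u.1 * chart_inv b u.2)%g.

Lemma chart_mul_differentiable a b c x y :
  atlas a -> atlas b -> atlas c ->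
  chart_dom a x -> chart_dom b y -> chart_dom c (x * y)%g ->
  differentiable (chart_mul a b c) (a x, b y).
Proof.
move=> Aa Ab Ac dx dy dxy.
have [H _] := @lie_mul_smooth _ _ G a b c Aa Ab Ac 1%N.
apply: H; split => /=; [exact: chart_im_map|exact: chart_im_map|].
by rewrite !chart_invK_dom.
Qed.

Lemma differentiable_lmul a b g x :
  atlas a -> atlas b -> chart_dom a x -> chart_dom b (g * x)%g ->
  differentiable (fun y => b (g * chart_inv a y)%g) (a x).
Proof.
move=> Aa Ab dx dgx; have [c Ac dg] := atlas_cover (s := G) g.
have -> : (fun y => b (g * chart_inv a y)%g) =
  chart_mul c a b \o (fun y => (c g, y)).
  by apply/funext => y; rewrite /chart_mul/= chart_invK_dom.
apply: differentiable_comp; first exact: differentiable_pair.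
exact: chart_mul_differentiable.
Qed.

Lemma differentiable_rmul a b g x :
  atlas a -> atlas b -> chart_dom a x -> chart_dom b (x * g)%g ->
  differentiable (fun y => b (chart_inv a y * g)%g) (a x).
Proof.
move=> Aa Ab dx dgx; have [c Ac dg] := atlas_cover (s := G) g.
have -> : (fun y => b (chart_inv a y * g)%g) =
  chart_mul a c b \o (fun y => (y, c g)).
  by apply/funext => y; rewrite /chart_mul/= chart_invK_dom.
apply: differentiable_comp; first exact: differentiable_pair.
exact: chart_mul_differentiable.
Qed.

Section AtUnit.
Variable e : chart R n G.
Hypotheses (Ae : atlas e) (e1 : chart_dom e 1%g).

Local Notation o := (e 1%g).
Local Notation ei := (chart_inv e).
Local Notation V := 'rV[R]_n.

Lemma ei_cvg : ei y @[y --> o] --> (1%g : G).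
Proof. exact: chart_inv_cvg. Qed.

Lemma conj_cvg g : (g * ei y * g^-1)%g @[y --> o] --> (1%g : G).
Proof.
rewrite -[X in _ --> X](mulgV g) -[X in _ --> (X / _)%g](mulg1 g).
apply: (@mulg_cvg _ (nbhs o)); last exact: cvg_cst.
by apply: (@mulg_cvg _ (nbhs o)); [exact: cvg_cst|exact: ei_cvg].
Qed.

Definition Ad g : V -> V := 'd (fun y => e (g * ei y * g^-1)%g) o.

Lemma Ad_linear g : linear (Ad g).
Proof. exact: linearP. Qed.

Lemma differentiable_conj g : differentiable (fun y => e (g * ei y * g^-1)%g) o.
Proof.
have [a Aa dg] := atlas_cover (s := G) g.
pose l y := a (g * ei y)%g.
have dl : differentiable l o.
  by apply: differentiable_lmul => //; rewrite mulg1.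
have dr : differentiable (fun z => e (chart_inv a z * g^-1)%g) (l o).
  rewrite /l chart_invK_dom // mulg1.
  by apply: differentiable_rmul => //; rewrite mulgV.
have [H _] : is_diff o (fun y => e (g * ei y * g^-1)%g)
    ('d ((fun z => e (chart_inv a z * g^-1)%g) \o l) o).
  apply: near_eq_is_diff; last first.
    by apply: DiffDef => //; exact: differentiable_comp.
  have gc : (g * ei y)%g @[y --> o] --> g.
    rewrite -[X in _ --> X](mulg1 g).
    by apply: (@mulg_cvg _ (nbhs o)); [exact: cvg_cst|exact: ei_cvg].
  apply: filterS (near_cvg_dom gc dg) => y /= dy.
  by rewrite /l chart_invK_dom.
by [].
Qed.

Lemma is_diff_conj g : is_diff o (fun y => e (g * ei y * g^-1)%g) (Ad g).
Proof. by apply: DiffDef => //; exact: differentiable_conj. Qed.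

Lemma curve_conj p g t v : p s @[s --> t] --> (1%g : G) -> p t = 1%g ->
  is_derive t (1 : R) (fun s => e (p s)) v ->
  is_derive t (1 : R) (fun s => e (g * p s * g^-1)%g) (Ad g v).
Proof.
move=> pc p1 dp.
have H : is_diff (e (p t)) (fun y => e (g * ei y * g^-1)%g) (Ad g).
  by rewrite p1; exact: is_diff_conj.
apply: near_eq_is_derive (is_derive_comp_curve H dp).
apply: filterS (near_cvg_dom pc e1) => s ds.
by rewrite chart_invK_dom.
Qed.

Local Notation m := (chart_mul e e e).

Lemma near_chart_mulr1 : \forall x \near o, m (x, o) = x.
Proof.
apply: filterS (near_chart_im e1) => x ix.
by rewrite /m/= chart_invK_dom // mulg1 chart_mapK_im.
Qed.

Lemma near_chart_mul1r : \forall x \near o, m (o, x) = x.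
Proof.
apply: filterS (near_chart_im e1) => x ix.
by rewrite /m/= chart_invK_dom // mul1g chart_mapK_im.
Qed.

Lemma differentiable_mul_unit : differentiable m (o, o).
Proof. by apply: chart_mul_differentiable => //; rewrite mulg1. Qed.

Lemma diff_mul_unit_left v : 'd m (o, o) (v, 0) = v.
Proof.
have d1 : is_derive (0 : R) (1 : R) (fun s : R => (s *: v + o, o)) (v, 0 : V).
  by apply: is_derive_pair; exact: is_derive_affine_line.
have H : is_diff ((0 : R) *: v + o, o) m ('d m (o, o)).
  by rewrite scale0r add0r; apply: DiffDef => //; exact: differentiable_mul_unit.
have H1 := is_derive_comp_curve (c := fun s : R => (s *: v + o, o)) H d1.
apply: is_derive_unique H1 _.
apply: near_eq_is_derive (is_derive_affine_line v o 0).
by apply: filterS (near_affine_line v near_chart_mulr1) => s ->.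
Qed.

Lemma diff_mul_unit_right v : 'd m (o, o) (0, v) = v.
Proof.
have d1 : is_derive (0 : R) (1 : R) (fun s : R => (o, s *: v + o)) (0 : V, v).
  by apply: is_derive_pair; exact: is_derive_affine_line.
have H : is_diff (o, (0 : R) *: v + o) m ('d m (o, o)).
  by rewrite scale0r add0r; apply: DiffDef => //; exact: differentiable_mul_unit.
have H1 := is_derive_comp_curve (c := fun s : R => (o, s *: v + o)) H d1.
apply: is_derive_unique H1 _.
apply: near_eq_is_derive (is_derive_affine_line v o 0).
by apply: filterS (near_affine_line v near_chart_mul1r) => s ->.
Qed.

Lemma is_diff_mul_unit : is_diff (o, o) m (fun u => u.1 + u.2).
Proof.
apply: DiffDef; first exact: differentiable_mul_unit.
apply/funext => -[v w] /=; rewrite -[in RHS](diff_mul_unit_left v).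
rewrite -[in RHS](diff_mul_unit_right w).
by rewrite -linearD; congr ('d m _ _); congr pair; rewrite /= ?addr0 ?add0r.
Qed.

Lemma curve_mul p q t v w :
  p s @[s --> t] --> (1%g : G) -> p t = 1%g ->
  q s @[s --> t] --> (1%g : G) -> q t = 1%g ->
  is_derive t (1 : R) (fun s => e (p s)) v ->
  is_derive t (1 : R) (fun s => e (q s)) w ->
  is_derive t (1 : R) (fun s => e (p s * q s)%g) (v + w).
Proof.
move=> pc p1 qc q1 dp dq.
have H : is_diff (e (p t), e (q t)) m (fun u => u.1 + u.2).
  by rewrite p1 q1; exact: is_diff_mul_unit.
have H1 := is_derive_comp_curve (c := fun s => (e (p s), e (q s))) H (is_derive_pair dp dq).
apply: near_eq_is_derive H1.
apply: filterS2 (near_cvg_dom pc e1) (near_cvg_dom qc e1) => s ds ds'.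
by rewrite /m/= !chart_invK_dom.
Qed.

Lemma curve_inv p t v :
  p s @[s --> t] --> (1%g : G) -> p t = 1%g ->
  is_derive t (1 : R) (fun s => e (p s)) v ->
  is_derive t (1 : R) (fun s => e (p s)^-1%g) (- v).
Proof.
move=> pc p1 dp.
pose i y := e (ei y)^-1%g.
have di : differentiable i (e (p t)).
  rewrite p1; have [H _] := @lie_inv_smooth _ _ G e e Ae Ae 1%N.
  by apply: H; split; [exact: chart_im_map|rewrite chart_invK_dom// invg1].
have H := is_derive_comp_curve (c := fun s => e (p s)) (differentiableP di) dp.
have dip : is_derive t (1 : R) (fun s => e (p s)^-1%g) ('d i (e (p t)) v).
  apply: near_eq_is_derive H.
  by apply: filterS (near_cvg_dom pc e1) => s ds; rewrite /i chart_invK_dom.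
have pVc : (p s)^-1%g @[s --> t] --> (1%g : G).
  by rewrite -[X in _ --> X]invg1; exact: invg_cvg.
have pV1 : (p t)^-1%g = 1%g by rewrite p1 invg1.
have := curve_mul pc p1 pVc pV1 dp dip.
under eq_fun do rewrite mulgV.
move=> /is_derive_unique/(_ (is_derive_cst _ _ _))/eqP.
by rewrite addrC addr_eq0 => /eqP <-.
Qed.

(** The left logarithmic derivative p(t)^-1 p'(t), as a tangent vector at 1.
Translating to 1 avoids any choice of a chart at p(t). *)
Definition logder p (t : R) (v : V) : Prop :=
  {for t, continuous p} /\ is_derive t (1 : R) (fun s => e ((p t)^-1 * p s)%g) v.

Lemma logder_cvg p t v : logder p t v ->
  ((p t)^-1 * p s)%g @[s --> t] --> (1%g : G).
Proof.
move=> [pc _]; rewrite -[X in _ --> X](mulVg (p t)).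
by apply: (@mulg_cvg _ (nbhs t)) => //; exact: cvg_cst.
Qed.

Lemma Ad1 v : Ad 1%g v = v.
Proof.
have H : is_diff o id (Ad 1%g).
  apply: near_eq_is_diff (is_diff_conj 1%g).
  apply: filterS (near_chart_im e1) => y iy.
  by rewrite mul1g invg1 mulg1 chart_mapK_im.
have [_ <-] := H.
by have [_ ->] := is_diff_id o.
Qed.

Lemma AdM g h v : Ad (g * h)%g v = Ad g (Ad h v).
Proof.
have H : is_diff o (fun y => e (g * h * ei y * (g * h)^-1)%g) (Ad g \o Ad h).
  have H1 : is_diff (e (h * ei o * h^-1)%g) (fun y => e (g * ei y * g^-1)%g) (Ad g).
    have -> : (h * ei o * h^-1 = 1)%g by rewrite chart_invK_dom // mulg1 mulgV.
    exact: is_diff_conj.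
  have H2 := is_diff_comp (is_diff_conj h) H1.
  apply: near_eq_is_diff H2.
  apply: filterS (near_cvg_dom (conj_cvg h) e1) => y dy /=.
  by rewrite chart_invK_dom // invgM !mulgA.
by have [_ HE] := H; exact: (congr1 (fun f => f v) HE).
Qed.

Lemma AdK g v : Ad g^-1%g (Ad g v) = v.
Proof. by rewrite -AdM mulVg Ad1. Qed.

Lemma AdVK g v : Ad g (Ad g^-1%g v) = v.
Proof. by rewrite -AdM mulgV Ad1. Qed.

Lemma logder_mul p q t v w : logder p t v -> logder q t w ->
  logder (fun s => p s * q s)%g t (Ad (q t)^-1%g v + w).
Proof.
move=> Lp Lq; split.
  by apply: (@mulg_cvg _ (nbhs t)); [exact: Lp.1|exact: Lq.1].
have Cp := logder_cvg Lp; have Cq := logder_cvg Lq.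
have Cc : ((q t)^-1 * ((p t)^-1 * p s) * (q t)^-1^-1)%g @[s --> t] --> (1%g : G).
  rewrite -[X in _ --> X](mulgV (q t)^-1%g) -[X in _ --> (X / _)%g](mulg1 (q t)^-1%g).
  apply: (@mulg_cvg _ (nbhs t)); last exact: cvg_cst.
  by apply: (@mulg_cvg _ (nbhs t)) => //; exact: cvg_cst.
have := curve_mul Cc _ Cq _ (curve_conj (q t)^-1%g Cp _ Lp.2) Lq.2.
rewrite !mulVg mulg1 mulgV => /(_ erefl erefl erefl).
congr is_derive; apply/funext => s; congr (e _).
by rewrite invgM invgK !mulgA mulgK.
Qed.

Lemma logder_inv p t v : logder p t v ->
  logder (fun s => (p s)^-1)%g t (- Ad (p t) v).
Proof.
move=> Lp; split; first by apply: invg_cvg; exact: Lp.1.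
have Cp := logder_cvg Lp.
have CVp : ((p t)^-1 * p s)^-1%g @[s --> t] --> (1%g : G).
  by rewrite -[X in _ --> X]invg1; exact: invg_cvg.
have := curve_conj (p t) CVp _ (curve_inv Cp _ Lp.2).
rewrite mulVg invg1 => /(_ erefl erefl).
rewrite /Ad linearN; congr is_derive; apply/funext => s; congr (e _).
by rewrite invgM !invgK !mulgA mulgK.
Qed.

Lemma logder_cst g t : logder (fun=> g) t 0.
Proof. by split; [exact: cvg_cst|exact: is_derive_cst]. Qed.

Lemma logder_lmul g p t v : logder p t v -> logder (fun s => g * p s)%g t v.
Proof.
move=> /(logder_mul (logder_cst g t)).
by rewrite /Ad linear0 add0r.
Qed.

Lemma logder_rmul g p t v : logder p t v ->
  logder (fun s => p s * g)%g t (Ad g^-1%g v).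
Proof. by move=> /logder_mul/(_ (logder_cst g t)); rewrite addr0. Qed.

Lemma logder_comp p (f : R -> R) t v f' : logder p (f t) v ->
  is_derive t (1 : R) f f' -> logder (p \o f) t (f' *: v).
Proof.
move=> [pc pd] fd.
have fD : differentiable f t by apply/derivable1_diffP; exact: (@ex_derive _ _ _ _ _ _ _ fd).
split.
  apply: continuous_comp; last exact: pc.
  exact: differentiable_continuous.
exact: is_derive_chain pd fd.
Qed.

(** The chart expression of the derivative of the exponential curve is
that of the left translation at exp (t X); translating back by exp (t X)^-1
undoes it. *)
Lemma logder_exp (exp : V -> G) X t : is_lie_exp e exp ->
  logder (fun s => exp (s *: X)) t X.
Proof.
move=> /(_ X)[_ Ec Ed]; split; first exact: Ec.
set g := exp (t *: X); have [a Aa dg] := atlas_cover (s := G) g.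
have dN : differentiable (fun z => e (g^-1 * chart_inv a z)%g) (a g).
  by apply: differentiable_lmul => //; rewrite mulVg.
have dl : differentiable (fun y => a (g * ei y)%g) o.
  by apply: differentiable_lmul => //; rewrite mulg1.
have XE : 'd (fun z => e (g^-1 * chart_inv a z)%g) (a g) (left_field e X a (a g)) = X.
  rewrite /left_field chart_invK_dom //.
  have dN' : is_diff (a (g * ei o)%g) (fun z => e (g^-1 * chart_inv a z)%g)
      ('d (fun z => e (g^-1 * chart_inv a z)%g) (a g)).
    have -> : (g * ei o = g)%g by rewrite chart_invK_dom // mulg1.
    exact: differentiableP.
  have H := is_diff_comp (differentiableP dl) dN'.
  have gc : (g * ei y)%g @[y --> o] --> g.
    rewrite -[X in _ --> X](mulg1 g).
    by apply: (@mulg_cvg _ (nbhs o)); [exact: cvg_cst|exact: ei_cvg].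
  have H2 : is_diff o id ('d (fun z => e (g^-1 * chart_inv a z)%g) (a g) \o
     'd (fun y => a (g * ei y)%g) o).
    apply: near_eq_is_diff H.
    apply: filterS2 (near_cvg_dom gc dg) (near_chart_im e1) => y dy iy /=.
    by rewrite chart_invK_dom // mulKg chart_mapK_im.
  have [_ E2] := H2; have [_ E] := is_diff_id o.
  exact: (congr1 (fun f => f X) (etrans (esym E2) E)).
have H := is_derive_comp_curve (c := fun s => a (exp (s *: X)))
  (differentiableP dN) (Ed a t Aa dg).
rewrite -/g XE in H.
apply: near_eq_is_derive H.
apply: filterS (near_cvg_dom (Ec t) dg) => s ds.
by rewrite chart_invK_dom.
Qed.

(** A translate of p has zero derivative in the chart e. *)
Lemma near_logder0 p t v : logder p t v ->
  (\forall s \near t, logder p s 0) -> \forall s \near t, p s = p t.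
Proof.
move=> Lp L0; have Cp := logder_cvg Lp.
have [r /= r0 Hr] :=
  (nbhs_ballP _ _).1 (@filterI _ (nbhs t) _ _ _ L0 (near_cvg_dom Cp e1)).
have dE s : ball t r s -> is_derive s (1 : R) (fun s => e ((p t)^-1 * p s)%g) 0.
  move=> /Hr[Ls ds]; set h := ((p t)^-1 * p s)%g.
  have dl : differentiable (fun y => e (h * ei y)%g) (e ((p s)^-1 * p s)%g).
    by rewrite mulVg; apply: differentiable_lmul => //; rewrite mulg1.
  have H := is_derive_comp_curve (c := fun z => e ((p s)^-1 * p z)%g)
    (differentiableP dl) Ls.2.
  rewrite linear0 in H; apply: near_eq_is_derive H.
  apply: filterS (near_cvg_dom (logder_cvg Ls) e1) => z dz.
  by rewrite chart_invK_dom // /h -mulgA mulVKg.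
have itv : is_interval (ball t r : set R).
  by rewrite ball_itv; exact: interval_is_interval.
near=> s.
have bs : ball t r s by near: s; exact: nbhsx_ballx.
have := derive0_cst_interval_mx itv dE (ballxx t r0) bs.
move=> /(congr1 ei); rewrite mulVg !chart_invK_dom //; last exact: (Hr _ bs).2.
by move=> /(congr1 (fun z => p t * z)%g); rewrite mulg1 mulVKg.
Unshelve. all: by end_near. Qed.

(** The indicator function of the set where p takes the value p s is locally
constant, so its derivative vanishes and the scalar case applies. *)
Lemma logder0_cst (I : set R) p : open I -> is_interval I ->
  (forall s, I s -> logder p s 0) -> forall s t, I s -> I t -> p s = p t.
Proof.
move=> oI itv L0 s t Is It.
pose chi (z : R) : R := (`[< p z = p s >])%:R.
have dchi z : I z -> is_derive z (1 : R) chi 0.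
  move=> Iz.
  have H := @is_derive_cst _ R R (chi z) z (1 : R).
  apply: near_eq_is_derive H.
  have L0z : \forall s \near z, logder p s 0.
    by have := open_nbhs_nbhs (conj oI Iz); apply: filterS.
  by apply: filterS (near_logder0 (L0 _ Iz) L0z) => u; rewrite /chi => ->.
have := derive0_cst_interval itv dchi Is It.
rewrite /chi asboolT //; case: asboolP => [->//|_].
by move=> /eqP; rewrite oner_eq0.
Qed.

(** The curve p q^-1 has vanishing logarithmic derivative. *)
Lemma logder_uniq (I : set R) p q (v : R -> V) (t0 : R) : open I -> is_interval I ->
  (forall t, I t -> logder p t (v t)) -> (forall t, I t -> logder q t (v t)) ->
  I t0 -> p t0 = q t0 -> forall t, I t -> p t = q t.
Proof.
move=> oI itv Lp Lq I0 pq0 t It.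
have L0 s : I s -> logder (fun s => p s * (q s)^-1)%g s 0.
  move=> Is; have := logder_mul (Lp s Is) (logder_inv (Lq s Is)).
  by rewrite invgK addrN.
have := logder0_cst oI itv L0 I0 It; rewrite pq0 mulgV => H.
by apply/esym; rewrite -[LHS]mul1g H mulgVK.
Qed.

Lemma near_mul_domain : \forall u \near (o, o),
  [/\ chart_im e u.1, chart_im e u.2 & chart_dom e (ei u.1 * ei u.2)%g].
Proof.
have c1 : (u.1 : V) @[u --> (o, o)] --> o by exact: cvg_fst.
have c2 : (u.2 : V) @[u --> (o, o)] --> o by exact: cvg_snd.
have n1 : \forall u \near (o, o), chart_im e (u.1 : V).
  exact: (c1 _ (near_chart_im e1)).
have n2 : \forall u \near (o, o), chart_im e (u.2 : V).
  exact: (c2 _ (near_chart_im e1)).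
have d1 : ei (u.1 : V) @[u --> (o, o)] --> (1%g : G).
  by apply: (cvg_comp _ _ c1); exact: ei_cvg.
have d2 : ei (u.2 : V) @[u --> (o, o)] --> (1%g : G).
  by apply: (cvg_comp _ _ c2); exact: ei_cvg.
have d12 : (ei u.1 * ei u.2)%g @[u --> (o, o)] --> (1%g : G).
  by rewrite -[X in _ --> X](mulg1 1%g); exact: (@mulg_cvg _ (nbhs (o, o))).
by apply: filterS3 n1 n2 (near_cvg_dom d12 e1) => u; split.
Qed.

Lemma near_differentiable_mul : \forall u \near (o, o), differentiable m u.
Proof.
have [H _] := @lie_mul_smooth _ _ G e e e Ae Ae Ae 1%N.
by apply: filterS near_mul_domain => u; exact: H.
Qed.

Lemma differentiable_diff_mul W : differentiable (fun u => 'd m u W) (o, o).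
Proof.
have [_ H] := @lie_mul_smooth _ _ G e e e Ae Ae Ae 2%N.
have [H1 _] := H W; apply: H1.
by split=> /=; rewrite ?chart_invK_dom ?mulg1//; exact: chart_im_map.
Qed.

Lemma differentiable_mul_at_unit h : chart_dom e h -> differentiable m (e h, o).
Proof. by move=> dh; apply: chart_mul_differentiable => //; rewrite mulg1. Qed.

Lemma is_diff_left_mul h : chart_dom e h ->
  is_diff o (fun y => m (e h, y)) (fun Y => 'd m (e h, o) (0, Y)).
Proof.
move=> dh.
have H1 : is_diff o (fun y : V => (e h, y)) (fun Y : V => (0 : V, Y)).
  exact: (@is_diff_pair _ _ _ _ (cst (e h)) 0 id id).
exact: (is_diff_comp H1 (differentiableP (differentiable_mul_at_unit dh))).
Qed.

Lemma is_diff_left_field Y :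
  is_diff o (left_field e Y e) (fun X => 'd (fun u => 'd m u (0, Y)) (o, o) (X, 0)).
Proof.
have H1 : is_diff o (fun x : V => (x, o)) (fun X : V => (X, 0 : V)).
  exact: (@is_diff_pair _ _ _ _ id id (cst o) 0).
have H := is_diff_comp H1 (differentiableP (differentiable_diff_mul (0, Y))).
apply: near_eq_is_diff H.
apply: filterS (near_chart_im e1) => x ix.
have [_ E] := is_diff_left_mul (chart_inv_dom ix).
rewrite chart_mapK_im // in E.
by rewrite /left_field; apply/esym; exact: (congr1 (fun f => f Y) E).
Qed.

Lemma diff_mul_by_unit h Y : chart_dom e h -> 'd m (e h, o) (Y, 0) = Y.
Proof.
move=> dh.
have H1 : is_diff (e h) (fun x : V => (x, o)) (fun X : V => (X, 0 : V)).
  exact: (@is_diff_pair _ _ _ _ id id (cst o) 0).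
have H := is_diff_comp H1 (differentiableP (differentiable_mul_at_unit dh)).
have H2 : is_diff (e h) id (fun X : V => 'd m (e h, o) (X, 0)).
  apply: near_eq_is_diff H; apply: filterS (near_chart_im dh) => x ix.
  by rewrite /m/= chart_invK_dom // mulg1 chart_mapK_im.
have [_ E2] := H2; have [_ E] := is_diff_id (e h).
exact: (congr1 (fun f => f Y) (etrans (esym E2) E)).
Qed.

Local Notation d2m W Z := ('d (fun u => 'd m u W) (o, o) Z).

Lemma d2m_left_left X Y : d2m (Y, 0) (X, 0) = 0.
Proof.
have H1 : is_diff o (fun x : V => (x, o)) (fun X : V => (X, 0 : V)).
  exact: (@is_diff_pair _ _ _ _ id id (cst o) 0).
have H := is_diff_comp H1 (differentiableP (differentiable_diff_mul (Y, 0))).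
have H2 : is_diff o (cst Y : V -> V) (fun X => d2m (Y, 0) (X, 0)).
  apply: near_eq_is_diff H; apply: filterS (near_chart_im e1) => x ix /=.
  by rewrite -(chart_mapK_im ix) diff_mul_by_unit //; exact: chart_inv_dom.
have [_ E2] := H2; have [_ E] := is_diff_cst Y o.
exact: (congr1 (fun f => f X) (etrans (esym E2) E)).
Qed.

(** The half (X, 0) contributes nothing, because 'd m (h, 1) (Y, 0) = Y does not
depend on h; in the half (0, - X) the symmetry of the second derivative
exchanges the two vectors. *)
Lemma d2m_antidiagonal X Y : d2m (Y, 0) (X, - X) = - d2m (0, X) (Y, 0).
Proof.
have -> : (X, - X) = (X, 0 : V) - (0 : V, X).
  by congr pair; rewrite /= ?subr0 ?sub0r.
apply: etrans (linearB _ _ _) _.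
apply: etrans (congr1 (fun z => z - _) (d2m_left_left X Y)) _.
apply: etrans (sub0r _) _; congr (- _).
exact: schwarz_rV near_differentiable_mul (differentiable_diff_mul _)
  (differentiable_diff_mul _).
Qed.

Lemma lie_bracketE X Y :
  lie_bracket e X Y = d2m (0, Y) (X, 0) - d2m (0, X) (Y, 0).
Proof.
have [_ EY] := is_diff_left_field Y; have [_ EX] := is_diff_left_field X.
congr (_ - _); first exact: (congr1 (fun f => f X) EY).
exact: (congr1 (fun f => f Y) EX).
Qed.

(** The conjugation h y h^-1 is the product of h y, which moves in y, and of the
constant h^-1. *)
Lemma Ad_diff_mul h Y : chart_dom e h -> chart_dom e h^-1%g ->
  Ad h Y = 'd m (e h, e h^-1%g) ('d m (e h, o) (0, Y), 0).
Proof.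
move=> dh dhV.
have mE : m (e h, o) = e h by rewrite /m/= !chart_invK_dom // mulg1.
have H1 := is_diff_left_mul dh.
have H2 : is_diff (m (e h, o)) (fun x : V => (x, e h^-1%g)) (fun X : V => (X, 0 : V)).
  exact: (@is_diff_pair _ _ _ _ id id (cst (e h^-1%g)) 0).
have H3 := is_diff_comp H1 H2.
have dm2 : differentiable m (((fun x : V => (x, e h^-1%g)) \o (fun y => m (e h, y))) o).
  by rewrite /= mE; apply: chart_mul_differentiable => //; rewrite mulgV.
have H := is_diff_comp H3 (differentiableP dm2).
have H4 : is_diff o (fun y => e (h * ei y * h^-1)%g)
   ('d m (((fun x : V => (x, e h^-1%g)) \o (fun y => m (e h, y))) o) \o
     ((fun X : V => (X, 0 : V)) \o (fun Y => 'd m (e h, o) (0, Y)))).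
  apply: near_eq_is_diff H.
  have gc : (h * ei y)%g @[y --> o] --> h.
    rewrite -[X in _ --> X](mulg1 h).
    by apply: (@mulg_cvg _ (nbhs o)); [exact: cvg_cst|exact: ei_cvg].
  apply: filterS (near_cvg_dom gc dh) => y dy.
  rewrite /m/= !chart_invK_dom //; by rewrite chart_invK_dom.
have [_ E] := H4; rewrite /= mE in E.
exact: (congr1 (fun f => f Y) E).
Qed.

(** [Ad h Y] is given near 1 by first derivatives of the multiplication m at
(h, 1) and (h, h^-1). Along a curve through 1 with velocity X, the product
rule yields D(0,Y)(X,0) + D(Y,0)(X,-X), where D W Z is the derivative along
Z of u |-> 'd m u W at (1, 1); this is the bracket. The linear map 'd m is
expanded in a basis so that the product rule applies entrywise. *)
Lemma is_derive_Ad_curve p t X Y :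
  p s @[s --> t] --> (1%g : G) -> p t = 1%g ->
  is_derive t (1 : R) (fun s => e (p s)) X ->
  is_derive t (1 : R) (fun s => Ad (p s) Y) (lie_bracket e X Y).
Proof.
move=> pc p1 dp.
have dpV := curve_inv pc p1 dp.
have pVc : (p s)^-1%g @[s --> t] --> (1%g : G).
  by rewrite -[X in _ --> X]invg1; exact: invg_cvg.
pose l s := 'd m (e (p s), o) (0, Y).
pose q s := (e (p s), e (p s)^-1%g).
pose K W s := 'd m (q s) (W, 0).
have qo : q t = (o, o) by rewrite /q p1 invg1.
have dl : is_derive t (1 : R) l (d2m (0, Y) (X, 0)).
  have D1 := differentiableP (differentiable_diff_mul (0, Y)).
  rewrite -p1 in D1.
  have dq : is_derive t (1 : R) (fun s => (e (p s), o)) (X, 0).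
    exact: is_derive_pair.
  have D2 : is_diff (e (p t), o) (fun u => 'd m u (0, Y))
     ('d (fun u => 'd m u (0, Y)) (o, o)).
    by rewrite p1; exact: differentiableP (differentiable_diff_mul _).
  exact: (is_derive_comp_curve (c := fun s => (e (p s), o)) D2 dq).
have dK W : is_derive t (1 : R) (K W) (d2m (W, 0) (X, - X)).
  have dq : is_derive t (1 : R) q (X, - X) by exact: is_derive_pair.
  have D2 : is_diff (q t) (fun u => 'd m u (W, 0))
     ('d (fun u => 'd m u (W, 0)) (o, o)).
    by rewrite qo; exact: differentiableP (differentiable_diff_mul _).
  exact: (is_derive_comp_curve D2 dq).
have KE W s : K W s = \sum_k W 0 k *: K (delta_mx 0 k) s.
  pose L : V -> V := fun W => 'd m (q s) (W, 0).
  have lin : linear L.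
    move=> a u v; rewrite /L -linearP; congr ('d m (q s) _).
    by congr pair; rewrite /= ?scaler0 ?addr0.
  pose LL : {linear V -> V} := HB.pack L (GRing.isLinear.Build _ _ _ _ _ lin).
  have -> : K W s = LL W by [].
  rewrite {1}(row_sum_delta W) linear_sum; apply: eq_bigr => k _.
  by rewrite linearZ.
have Kt W : K W t = W by rewrite /K qo; exact: diff_mul_unit_left.
have lt : l t = Y by rewrite /l p1; exact: diff_mul_unit_right.
have near_Ad : \forall s \near t, \sum_k l s 0 k *: K (delta_mx 0 k) s = Ad (p s) Y.
  apply: filterS2 (near_cvg_dom pc e1) (near_cvg_dom pVc e1) => s ds ds'.
  by rewrite -KE Ad_diff_mul.
apply: near_eq_is_derive near_Ad _.
have dlK := is_derive_sum_scale (fun k => is_derive_coord 0 k dl)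
  (fun k => dK (delta_mx 0 k)).
apply: is_derive_eq dlK _.
rewrite big_split /= lt; under eq_bigr do rewrite Kt.
rewrite -row_sum_delta.
have -> : \sum_k Y 0 k *: d2m (delta_mx 0 k, 0) (X, - X) = d2m (Y, 0) (X, - X).
  apply: is_derive_unique (dK Y).
  have := is_derive_sum_scale (fun k => is_derive_cst (Y 0 k) t (1 : R))
    (fun k => dK (delta_mx 0 k)).
  under eq_fun do rewrite -KE.
  by move=> H; apply: is_derive_eq H _; apply: eq_bigr => k _; rewrite scale0r add0r.
rewrite lie_bracketE.
congr (_ + _); exact: d2m_antidiagonal.
Qed.

(** Reduces to curves through 1, since Ad (p s) = Ad (p t) Ad (p(t)^-1 p(s)). *)
Lemma logder_Ad p t v Y : logder p t v ->
  is_derive t (1 : R) (fun s => Ad (p s) Y) (Ad (p t) (lie_bracket e v Y)).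
Proof.
move=> Lp.
have := is_derive_linear (Ad_linear (p t))
  (is_derive_Ad_curve Y (logder_cvg Lp) (mulVg _) Lp.2).
by under eq_fun do rewrite -AdM mulgA mulgV mul1g.
Qed.

Local Notation "[[ X , Y ]]" := (lie_bracket e X Y) (at level 0, X, Y at level 99).

Lemma lie_bracketC X Y : [[X, Y]] = - [[Y, X]].
Proof. by rewrite /lie_bracket opprB. Qed.

Lemma lie_bracket_linearl Y : linear ((lie_bracket e)^~ Y).
Proof.
have E X : [[X, Y]] = d2m (0, Y) (X, 0) - d2m (Y, 0) (0, X).
  rewrite lie_bracketE; congr (_ - _).
  exact: schwarz_rV near_differentiable_mul (differentiable_diff_mul _)
  (differentiable_diff_mul _).
move=> a X X'; rewrite !E.
have -> : (a *: X + X', 0 : V) = a *: (X, 0 : V) + (X', 0 : V).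
  by congr pair; rewrite /= scaler0 addr0.
have -> : (0 : V, a *: X + X') = a *: (0 : V, X) + (0 : V, X').
  by congr pair; rewrite /= scaler0 addr0.
apply: etrans (congr2 (fun u v => u - v) (linearP _ _ _ _) (linearP _ _ _ _)) _.
by rewrite scalerBr opprD addrACA.
Qed.

Lemma lie_bracket_linearr X : linear (lie_bracket e X).
Proof.
move=> a Y Y'; apply: etrans (lie_bracketC _ _) _.
apply: etrans (congr1 -%R (lie_bracket_linearl X a Y Y')) _.
rewrite opprD -scalerN; apply/esym.
exact: (congr2 (fun u v => a *: u + v) (lie_bracketC X Y) (lie_bracketC X Y')).
Qed.

Variable exp : V -> G.
Hypothesis Hexp : is_lie_exp e exp.

Lemma exp0 : exp 0 = 1%g.
Proof. by have [] := Hexp 0. Qed.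

Lemma logder_expZ X t : logder (fun s => exp (s *: X)) t X.
Proof. exact: logder_exp. Qed.

Lemma exp_uniq p X t0 : (forall t, logder p t X) -> p t0 = exp (t0 *: X) ->
  forall t, p t = exp (t *: X).
Proof.
move=> Lp p0 t.
apply: (@logder_uniq setT p (fun t => exp (t *: X)) (fun=> X) t0) => //.
  exact: openT.
by move=> s _; exact: logder_exp.
Qed.

Lemma exp_conj g X t : (g * exp (t *: X) * g^-1)%g = exp (t *: Ad g X).
Proof.
apply: (@exp_uniq (fun t => g * exp (t *: X) * g^-1)%g (Ad g X) 0).
  move=> s; rewrite -[in Ad g X](invgK g).
  by apply: logder_rmul; apply: logder_lmul; exact: logder_exp.
by rewrite !scale0r !exp0 mulg1 mulgV.
Qed.

Lemma logder_exp_fun (f : R -> R) f' X t : is_derive t (1 : R) f f' ->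
  logder (fun s => exp (f s *: X)) t (f' *: X).
Proof.
by move=> df; apply: (logder_comp (p := fun s => exp (s *: X))) df; exact: logder_exp.
Qed.

Lemma exp_add s t X : exp ((s + t) *: X) = (exp (s *: X) * exp (t *: X))%g.
Proof.
apply/esym.
apply: (@logder_uniq setT (fun t => exp (s *: X) * exp (t *: X))%g
   (fun t => exp ((s + t) *: X)) (fun=> X) 0) => //; first exact: openT.
- by move=> z _; apply: logder_lmul; exact: logder_exp.
- move=> z _; rewrite -[X in logder _ _ X]scale1r; apply: logder_exp_fun.
  by apply: is_derive_eq (is_deriveD _ _) _; rewrite add0r.
- by rewrite addr0 scale0r exp0 mulg1.
Qed.

(** Differentiate Ad (g exp(sX) g^-1) Ad g Y = Ad g Ad (exp(sX)) Y at s = 0. *)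
Lemma Ad_bracket g X Y : Ad g [[X, Y]] = [[Ad g X, Ad g Y]].
Proof.
have L1 : logder (fun s => g * exp (s *: X) * g^-1)%g 0 (Ad g X).
  rewrite -[in Ad g X](invgK g); apply: logder_rmul; apply: logder_lmul.
  exact: logder_exp.
have := logder_Ad (Ad g Y) L1.
rewrite scale0r exp0 mulg1 mulgV Ad1.
under eq_fun do rewrite -AdM mulgVK AdM.
have := is_derive_linear (Ad_linear g) (logder_Ad Y (logder_expZ X 0)).
rewrite scale0r exp0 Ad1.
exact: is_derive_unique.
Qed.

(** The derivative at s = 0 of Ad (exp(sX)) [Y, Z] = [Ad (exp(sX)) Y, Ad (exp(sX)) Z]. *)
Lemma jacobi X Y Z : [[X, [[Y, Z]]]] = [[ [[X, Y]], Z]] + [[Y, [[X, Z]]]].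
Proof.
have D W := logder_Ad W (logder_expZ X 0).
have := D [[Y, Z]]; under eq_fun do rewrite Ad_bracket.
have := is_derive_bilinear lie_bracket_linearl lie_bracket_linearr (D Y) (D Z).
rewrite !scale0r !exp0 !Ad1 => /[swap]; exact: is_derive_unique.
Qed.

Lemma is_derive_Ad_exp X Y t : is_derive t (1 : R) (fun s => Ad (exp (s *: X)) Y)
  (Ad (exp (t *: X)) [[X, Y]]).
Proof. exact: logder_Ad (logder_expZ X t). Qed.

Lemma AdD g u v : Ad g (u + v) = Ad g u + Ad g v.
Proof. by rewrite /Ad linearD. Qed.

Lemma AdZ g (k : R) v : Ad g (k *: v) = k *: Ad g v.
Proof. by rewrite /Ad linearZ. Qed.

(** This is exp(- s ad X) Y, the series stopping after three terms. *)
Lemma Ad_exp_inv_quadratic X Y s : [[X, [[X, [[X, Y]]]]]] = 0 ->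
  Ad (exp (s *: X))^-1%g Y = Y - s *: [[X, Y]] + (s ^+ 2 / 2) *: [[X, [[X, Y]]]].
Proof.
move=> X3.
(* F is Ad (exp(tX)) applied to the right-hand side, and it is constant. *)
pose F (t : R) := Ad (exp (t *: X)) Y - t *: Ad (exp (t *: X)) [[X, Y]]
  + (t ^+ 2 / 2) *: Ad (exp (t *: X)) [[X, [[X, Y]]]].
have dF t : is_derive t (1 : R) F 0.
  have d0 := is_derive_Ad_exp X Y t.
  have d1 := is_derive_scale (is_derive_id t (1 : R)) (is_derive_Ad_exp X [[X, Y]] t).
  have dq : is_derive t (1 : R) (fun t : R => t ^+ 2 / 2) t.
    have H := is_derive_mulc 2^-1 (is_deriveM (is_derive_id t (1 : R)) (is_derive_id t (1 : R))).
    rewrite (_ : (fun t : R => t ^+ 2 / 2) = (fun t => 2^-1 * (id * id : R -> R) t)).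
      by apply: is_derive_eq H _; rewrite /GRing.scale /=; field.
    by apply/funext => u; rewrite mulrC expr2.
  have d2 := is_derive_scale dq (is_derive_Ad_exp X [[X, [[X, Y]]]] t).
  have H := is_deriveD (is_deriveB d0 d1) d2.
  apply: is_derive_eq H _; rewrite X3.
  have -> : Ad (exp (t *: X)) 0 = 0 by rewrite /Ad linear0.
  by rewrite scaler0 addr0 scale1r opprD addrA subrr sub0r addNr.
have FE t : F t = Ad (exp (t *: X)) (Y - t *: [[X, Y]] + (t ^+ 2 / 2) *: [[X, [[X, Y]]]]).
  by rewrite AdD -scaleNr AdD !AdZ scaleNr.
have F0 : F 0 = Y.
  by rewrite FE !scale0r exp0 Ad1 expr0n mul0r scale0r subr0 addr0.
have : F s = F 0.
  by apply: (@derive0_cst_interval_mx _ _ _ F setT) => // *; exact: dF.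
by rewrite F0 FE => H; rewrite -{1}H AdK.
Qed.

Lemma Ad_exp_inv_eigen H X (k : R) s : [[H, X]] = k *: X ->
  Ad (exp (s *: H))^-1%g X = expR (- (k * s)) *: X.
Proof.
move=> HX.
pose F (t : R) := expR (- (k * t)) *: Ad (exp (t *: H)) X.
have dF t : is_derive t (1 : R) F 0.
  have de : is_derive t (1 : R) (fun t => expR (- (k * t))) (- k * expR (- (k * t))).
    have d1 : is_derive t (1 : R) (fun t : R => - (k * t)) (- k).
      have D3 := is_deriveN (is_derive_mulc k (is_derive_id t (1 : R))).
      by apply: is_derive_eq D3 _; rewrite mulr1.
    exact: is_derive_chain (is_derive_expR _) d1.
  have D3 := is_derive_scale de (is_derive_Ad_exp H X t).
  apply: is_derive_eq D3 _; rewrite HX AdZ scalerA -scalerDl.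
  by rewrite [X in X *: _](_ : _ = 0) ?scale0r //; ring.
have : F s = F 0.
  by apply: (@derive0_cst_interval_mx _ _ _ F setT) => // *; exact: dF.
rewrite /F scale0r exp0 Ad1 mulr0 oppr0 expR0 scale1r => FsE.
by rewrite -{1}FsE AdZ AdK.
Qed.

End AtUnit.

End LieGroup.

(** * Linear fractional maps and Riccati equations *)

Section Riccati.
Context {R : realType}.

Definition mx22 (a b c d : R) : 'M[R]_2 :=
  \matrix_(i, j) (if i == 0 then if j == 0 then a else b
                  else if j == 0 then c else d).

Lemma det_mx22 a b c d : \det (mx22 a b c d) = a * d - b * c.
Proof.
rewrite (expand_det_row _ ord0) !big_ord_recl big_ord0 /cofactor.
by rewrite !det_mx11 !mxE /=; ring.
Qed.

Lemma mobius_mx22 a b c d t : mobius (mx22 a b c d) t = (a * t + b) / (c * t + d).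
Proof. by rewrite /mobius /mobius_num /mobius_den !mxE. Qed.

(** A vanishing discriminant means al + be x + ga x^2 = ga (x - r)^2 with
r = - be / (2 ga), so 1 / (phi - r) + ga t is constant; if ga = 0 then be = 0
and phi is affine. The matrix is divided by the square root of the absolute
value of its determinant. *)
Lemma riccati_mobius (I : set R) (phi : R -> R) al be ga :
  open_interval I ->
  (forall t, I t -> is_derive t (1 : R) phi (al + be * phi t + ga * phi t ^+ 2)) ->
  (forall t, I t -> al + be * phi t + ga * phi t ^+ 2 != 0) ->
  be ^+ 2 = 4 * al * ga ->
  exists M : 'M[R]_2, forall t, I t ->
    [/\ \det M = Num.sg (al + be * phi t + ga * phi t ^+ 2),
        mobius_den M t != 0 & phi t = mobius M t].
Proof.
move=> [oI itv [t0 I0]] dphi phi0 disc.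
have [ga0|ga0] := eqVneq ga 0.
  have be0 : be = 0.
    by move/eqP: disc; rewrite ga0 mulr0 expf_eq0 /= => /eqP.
  have al0 : al != 0 by have := phi0 _ I0; rewrite be0 ga0 !mul0r !addr0.
  have s0 : 0 < Num.sqrt `|al| by rewrite sqrtr_gt0 normr_gt0.
  set s := Num.sqrt `|al| in s0.
  have s2 : s ^+ 2 = `|al| by rewrite sqr_sqrtr.
  pose k := phi t0 - al * t0.
  have phiE t : I t -> phi t = al * t + k.
    move=> It.
    have dpsi x : I x -> is_derive x (1 : R) (fun x => phi x - al * x) 0.
      move=> Ix; have H := is_deriveB (dphi x Ix) (is_derive_mulc al (is_derive_id x (1 : R))).
      by apply: is_derive_eq H _; rewrite be0 ga0; ring.
    have := derive0_cst_interval itv dpsi It I0; rewrite -/k => <-; ring.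
  exists (mx22 (al / s) (k / s) 0 s^-1) => t It.
  rewrite det_mx22 mobius_mx22 /mobius_den !mxE /=; split.
  - rewrite be0 ga0 !mul0r !addr0 mulr0 subr0 -mulrA -invfM -expr2 s2.
    by rewrite {1}(numEsg al) mulfK // normr_eq0.
  - by rewrite mul0r add0r invr_eq0 gt_eqF.
  - by rewrite phiE // mul0r add0r; field; rewrite gt_eqF.
pose r := - be / (2 * ga).
have qE x : al + be * x + ga * x ^+ 2 = ga * (x - r) ^+ 2.
  have -> : al = be ^+ 2 / (4 * ga) by rewrite disc; field.
  by rewrite /r; field.
have pr0 t : I t -> phi t - r != 0.
  by move=> /phi0; rewrite qE; apply: contraNneq => ->; rewrite expr0n mulr0.
pose k := (phi t0 - r)^-1 + ga * t0.
have invE t : I t -> (phi t - r)^-1 = k - ga * t.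
  move=> It.
  have dpsi x : I x -> is_derive x (1 : R) (fun x => (phi x - r)^-1 + ga * x) 0.
    move=> Ix; have dr : is_derive x (1 : R) (fun x => phi x - r) (ga * (phi x - r) ^+ 2).
      have H := is_deriveB (dphi x Ix) (is_derive_cst r x (1 : R)).
      by apply: is_derive_eq H _; rewrite qE subr0.
    have H := is_deriveD (is_derive_inv_fun dr (pr0 x Ix))
      (is_derive_mulc ga (is_derive_id x (1 : R))).
    by apply: is_derive_eq H _; field; exact: pr0.
  have := derive0_cst_interval itv dpsi It I0; rewrite -/k => <-; ring.
have s0 : 0 < Num.sqrt `|ga| by rewrite sqrtr_gt0 normr_gt0.
set s := Num.sqrt `|ga| in s0.
have s2 : s ^+ 2 = `|ga| by rewrite sqr_sqrtr.
have sn0 : s != 0 by rewrite gt_eqF.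
exists (mx22 (- r * ga / s) ((r * k + 1) / s) (- ga / s) (k / s)) => t It.
have k0 : k - ga * t != 0 by rewrite -invE // invr_eq0 pr0.
rewrite det_mx22 mobius_mx22 /mobius_den !mxE /=.
have denE : - ga / s * t + k / s = (k - ga * t) / s by field.
split.
- rewrite qE sgrM (_ : Num.sg ((phi t - r) ^+ 2) = 1) ?mulr1; last first.
    by apply: gtr0_sg; rewrite exprn_even_gt0 //= pr0.
  have -> : - r * ga / s * (k / s) - (r * k + 1) / s * (- ga / s) = ga / s ^+ 2.
    by field.
  by rewrite s2 {1}(numEsg ga) mulfK // normr_eq0.
- by rewrite denE mulf_neq0 // invr_eq0.
- rewrite denE; have -> : phi t = r + (k - ga * t)^-1 by rewrite -invE // invrK; ring.
  by field; rewrite sn0 k0.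
Qed.

(** An affine function without zero on an interval has constant sign there. *)
Lemma mobius_den_sign (M : 'M[R]_2) (I : set R) t0 t :
  is_interval I -> (forall t, I t -> mobius_den M t != 0) -> I t0 -> I t ->
  0 < mobius_den M t / mobius_den M t0.
Proof.
move=> itv den0 I0 It; have d0 := den0 _ I0; set d := mobius_den M t0 in d0 *.
have q0 : mobius_den M t / d != 0 by rewrite mulf_neq0 ?invr_eq0 // den0.
rewrite lt_neqAle eq_sym q0 /= leNgt; apply/negP => q1.
set q := _ / d in q0 q1.
have q1' : 1 - q != 0 by rewrite gt_eqF // subr_gt0 (lt_trans q1).
(* If q is negative, the denominator vanishes at s, which lies between t0 and t. *)
pose s := t0 + (t - t0) / (1 - q).
have ds : mobius_den M s = 0.
  have -> : mobius_den M s = d + (mobius_den M t - d) / (1 - q).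
    by rewrite /s /d /mobius_den; field.
  have -> : mobius_den M t = q * d by rewrite /q divfK.
  by field.
have w0 : 0 <= (1 - q)^-1 <= 1.
  have h : 1 <= 1 - q by rewrite lerBrDr gerDl ltW.
  by rewrite invr_ge0 (le_trans ler01 h) invf_le1 // (lt_le_trans ltr01 h).
have : I s.
  move/andP: w0 => [w0 w1].
  have [tt|tt] := leP t0 t.
    apply: (itv t0 t) => //; rewrite /s lerDl mulr_ge0 ?subr_ge0 //=.
    by rewrite -lerBrDl ler_piMr ?subr_ge0.
  apply: (itv t t0) => //; rewrite /s gerDl.
  rewrite mulr_le0_ge0 ?subr_le0 ?(ltW tt) // andbT.
  by rewrite -lerBlDl ler_niMr ?subr_le0 ?(ltW tt).
by move=> /den0; rewrite ds eqxx.
Qed.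

End Riccati.

(** * Geodesics in G/P *)

Section Geodesics.
Context {R : realType} {n : nat} {G : lieGroupType R n}.
Variables (e : chart R n G) (exp : 'rV[R]_n -> G).
Variables (g : int -> {vspace 'rV[R]_n}) (P : set G).
Hypotheses (Ae : atlas e) (e1 : chart_dom e 1%g) (Hexp : is_lie_exp e exp).
Hypotheses (ss : semisimple e) (gr : is_grading1 e g) (par : is_parabolic exp g P).
Local Notation V := 'rV[R]_n.
Local Notation br := (lie_bracket e).
Local Notation Ad := (Ad e).
Local Notation prm := (prm g).
Local Notation pr0 := (pr0 g).
Local Notation pr1 := (pr1 g).

Let brl := lie_bracket_linearl Ae e1.
Let brr := lie_bracket_linearr Ae e1.
Let brC : forall x y, br x y = - br y x := lie_bracketC e.
Let jac := jacobi Ae e1 Hexp.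

Let g_out : forall i, 1 < `|i| -> g i = 0%VS. Proof. by have [] := gr. Qed.
Let g_full : (g (-1)%R + g 0%R + g 1%R = fullv)%VS. Proof. by have [] := gr. Qed.
Let g_direct : directv (g (-1)%R + g 0%R + g 1%R)%VS. Proof. by have [] := gr. Qed.
Let g_br : forall i j X Y, X \in g i -> Y \in g j -> br X Y \in g (i + j).
Proof. by have [] := gr. Qed.

Lemma killing_formE X Y : killing_form e X Y = trace_form br X Y.
Proof.
rewrite /killing_form /trace_form; congr (\tr _); apply: row_mul_inj => v.
have lin : linear (fun Z => br X (br Y Z)).
  move=> a u w; rewrite /= (brr Y a u w); exact: (brr X a (br Y u) (br Y w)).
pose L : {linear V -> V} := HB.pack (fun Z => br X (br Y Z)) (GRing.isLinear.Build _ _ _ _ _ lin).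
rewrite mulmxA (mul_ad_mx brr) (mul_ad_mx brr).
exact: (mul_rV_lin1 L).
Qed.

Lemma exists_grading_element :
  exists2 E, E \in g 0 & forall x, br E x = pr1 x - prm x.
Proof.
apply: (grading_element brl brr brC jac g_out g_full g_direct g_br).
by move=> x K0; apply: ss => y; rewrite killing_formE.
Qed.

Let P1 : P 1%g. Proof. by have [] := par. Qed.

Let PV x : P x -> P x^-1%g.
Proof. by move=> Px; have [_ _ PD _] := par; rewrite -[_^-1%g]mul1g; exact: PD. Qed.

Let PM x y : P x -> P y -> P (x * y)%g.
Proof.
move=> Px Py; have [_ _ PD _] := par.
by rewrite -[y]invgK; apply: PD => //; exact: PV.
Qed.

Let P_exp X : X \in (g 0 + g 1)%VS -> P (exp X).
Proof. by have [_ _ _ PE] := par => /PE/(_ 1); rewrite scale1r. Qed.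

Lemma left_coset_eq x y : left_coset P x = left_coset P y <-> P (x^-1 * y)%g.
Proof.
split=> [E|Pxy].
  have : left_coset P y y by exists 1%g => //; rewrite mulg1.
  by rewrite -E => -[p Pp <-]; rewrite mulKg.
apply/seteqP; split=> _ [p Pp <-].
  exists (y^-1 * x * p)%g; last by rewrite -mulgA mulVKg.
  by apply: PM => //; have := PV Pxy; rewrite invgM invgK.
by exists (x^-1 * y * p)%g; [exact: PM|rewrite -mulgA mulVKg].
Qed.

(** P is stable under conjugation and its Lie algebra is g_0 + g_1. *)
Lemma Ad_parabolic h W : P h -> prm W = 0 -> prm (Ad h W) = 0.
Proof.
move=> Ph W0; apply/eqP; rewrite -(prm_p g_full g_direct).
have [_ _ _ PE] := par; apply/PE => t.
rewrite -(exp_conj Ae e1 Hexp); apply: PM; last exact: PV.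
by apply: PM => //; move: t; apply/PE; rewrite (prm_p g_full g_direct) W0.
Qed.

(** The curve p(s) = exp(phi(s) X1)^-1 b exp(s X2) stays in P, so Ad (p s) W has
no component in g_{-1} when W has none. For W = Ad (p t)^-1 E its derivative
at t is [Ad (p t) X2 - phi'(t) X1, E], whose component in g_{-1} is that of
Ad (p t) X2 - phi'(t) X1. *)
Lemma tangency (I : set R) (phi phi' : R -> R) (b : G) (X1 X2 : V) :
  open I -> (forall t, I t -> is_derive t (1 : R) phi (phi' t)) ->
  (forall t, I t -> P ((exp (phi t *: X1))^-1 * b * exp (t *: X2))%g) ->
  X1 \in g (-1) ->
  forall t, I t -> prm (Ad (exp (phi t *: X1))^-1%g (Ad b X2)) = phi' t *: X1.
Proof.
move=> oI dphi Pp gX1 t It.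
have [E gE HE] := exists_grading_element.
pose p s := ((exp (phi s *: X1))^-1 * b * exp (s *: X2))%g.
have Ad_expX s X : Ad (exp (s *: X))^-1%g X = X.
  have X0 : br X X = (0 : R) *: X by rewrite (brxx brC) scale0r.
  by rewrite (Ad_exp_inv_eigen Ae e1 Hexp s X0) mul0r oppr0 expR0 scale1r.
have Ad_expX' s X : Ad (exp (s *: X)) X = X.
  by have := AdVK Ae e1 (exp (s *: X)) X; rewrite Ad_expX.
have Lp : logder e p t (Ad (exp (t *: X2))^-1%g (Ad b^-1%g (- (phi' t *: X1))) + X2).
  apply: (logder_mul Ae e1); last exact: logder_exp.
  apply: (logder_rmul Ae e1).
  have := logder_inv Ae e1 (logder_exp_fun Ae e1 Hexp X1 (dphi t It)).
  by rewrite AdZ Ad_expX'.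
have E0 : prm E = 0.
  by apply/eqP; rewrite -(prm_p g_full g_direct) -[E]addr0 memv_add ?mem0v.
pose W := Ad (p t)^-1%g E.
have W0 : prm W = 0 by apply: Ad_parabolic E0; apply: PV; exact: Pp.
have dN := logder_Ad Ae e1 W Lp.
have dprm := is_derive_linear (prm_linear g) dN.
have prm_cst : \forall s \near t, (0 : V) = prm (Ad (p s) W).
  have := open_nbhs_nbhs (conj oI It); apply: filterS => s Is.
  by rewrite (Ad_parabolic (Pp s Is) W0).
have := is_derive_unique dprm (near_eq_is_derive prm_cst (is_derive_cst 0 t (1 : R))).
rewrite (Ad_bracket Ae e1 Hexp) /W (AdVK Ae e1).
have -> : Ad (p t) (Ad (exp (t *: X2))^-1%g (Ad b^-1%g (- (phi' t *: X1))) + X2) =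
    Ad (exp (phi t *: X1))^-1%g (Ad b X2) - phi' t *: X1.
  have pE u : Ad (p t) u = Ad (exp (phi t *: X1))^-1%g (Ad b (Ad (exp (t *: X2)) u)).
    rewrite -(AdM Ae e1 b) -(AdM Ae e1 (exp (phi t *: X1))^-1%g).
    by rewrite /p mulgA.
  rewrite AdD (pE X2) (Ad_expX' t X2) addrC; congr (_ + _).
  rewrite pE (AdVK Ae e1 (exp (t *: X2))) (AdVK Ae e1 b).
  by rewrite -scaleNr AdZ (Ad_expX (phi t) X1).
set v := _ - _.
rewrite brC HE.
have gN : - pr1 v \in g 1 by rewrite memvN; exact: pr1_in.
have [H _ _] := prE g_full g_direct (prm_in g v) (mem0v (g 0)) gN.
have -> : - (pr1 v - prm v) = prm v + 0 - pr1 v by vec.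
rewrite H => v0; apply/eqP; rewrite -subr_eq0; apply/eqP; rewrite -[RHS]v0.
have gX : prm (phi' t *: X1) = phi' t *: X1.
  have [H1 _ _] := prE g_full g_direct (memvZ (phi' t) gX1) (mem0v (g 0)) (mem0v (g 1)).
  by rewrite !addr0 in H1.
have -> : v = -1 *: (phi' t *: X1) + Ad (exp (phi t *: X1))^-1%g (Ad b X2).
  by rewrite scaleN1r addrC.
by rewrite prm_linear gX scaleN1r addrC.
Qed.

Lemma riccati_coefficients (I : set R) (phi phi' : R -> R) (b : G) (X1 X2 : V) :
  open_interval I -> (forall t, I t -> is_derive t (1 : R) phi (phi' t)) ->
  (forall t, I t -> phi' t != 0) ->
  (forall t, I t -> P ((exp (phi t *: X1))^-1 * b * exp (t *: X2))%g) ->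
  X1 \in g (-1) -> X1 != 0 -> let Y := Ad b X2 in
  exists al be ga, [/\ prm Y = al *: X1, br X1 (pr0 Y) = - be *: X1,
    br X1 (br X1 (pr1 Y)) = (2 * ga) *: X1 &
    forall t, I t -> phi' t = al + be * phi t + ga * phi t ^+ 2].
Proof.
move=> [oI itv [t0 I0]] dphi phi0 Pp gX1 X10 Y.
have tan t : I t -> prm Y + phi t *: - br X1 (pr0 Y) +
    phi t ^+ 2 *: (2^-1 *: br X1 (br X1 (pr1 Y))) = phi' t *: X1.
  move=> It; rewrite -(tangency oI dphi Pp gX1 It).
  have nil := nilpotent_gm brl brr brC g_out g_full g_br Y gX1.
  rewrite (Ad_exp_inv_quadratic Ae e1 Hexp (phi t) nil).
  rewrite (prm_quadratic brr g_out g_full g_direct g_br Y (phi t) gX1).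
  by rewrite scalerN scalerA.
have [r /= r0 Hr] := (nbhs_ballP _ _).1 (open_nbhs_nbhs (conj oI I0)).
have Ir k : 0 <= k < r -> I (t0 + k).
  move=> /andP[k0 kr]; apply: Hr; rewrite -ball_normE /ball_/=.
  by rewrite opprD addrA subrr sub0r normrN ger0_norm.
have I1 : I (t0 + 0) by apply: Ir; lra.
have I2 : I (t0 + r / 4) by apply: Ir; lra.
have I3 : I (t0 + r / 2) by apply: Ir; lra.
have inj := derive_neq0_inj itv dphi phi0.
have n12 := inj _ _ I1 I2 ltac:(lra).
have n13 := inj _ _ I1 I3 ltac:(lra).
have n23 := inj _ _ I2 I3 ltac:(lra).
have in_line x : x \in [:: phi (t0 + 0); phi (t0 + r / 4); phi (t0 + r / 2)] ->
    prm Y + x *: - br X1 (pr0 Y) + x ^+ 2 *: (2^-1 *: br X1 (br X1 (pr1 Y)))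
      \in <[X1]>%VS.
  by rewrite !inE => /or3P[] /eqP ->; rewrite tan //; exact: memvZ (memv_line _).
have [/vlineP[al Ym] /vlineP[be Y0] /vlineP[ga Y1]] :=
  quadratic_in_subspace n12 n13 n23 in_line.
exists al, be, ga; split => //.
- by rewrite scaleNr -Y0 opprK.
- by rewrite -scalerA -Y1 scalerA mulfV ?scale1r // pnatr_eq0.
move=> t It; have := tan t It; rewrite Ym Y0 Y1 !scalerA -!scalerDl => /eqP.
rewrite -subr_eq0 -scalerBl scaler_eq0 (negbTE X10) orbF subr_eq0 => /eqP <-.
by rewrite (mulrC be) (mulrC ga).
Qed.

Lemma geodesic_reparametrization (I : set R) (phi phi' : R -> R) (b : G) (X1 X2 : V) :
  open_interval I -> (forall t, I t -> is_derive t (1 : R) phi (phi' t)) ->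
  (forall t, I t -> phi' t != 0) ->
  (forall t, I t -> P ((exp (phi t *: X1))^-1 * b * exp (t *: X2))%g) ->
  X1 \in g (-1) -> X2 \in g (-1) -> X1 != 0 ->
  exists M : 'M[R]_2, forall t, I t ->
    [/\ \det M = Num.sg (phi' t), mobius_den M t != 0 & phi t = mobius M t].
Proof.
move=> oI dphi phi0 Pp gX1 gX2 X10.
have [al [be [ga [Ym Y0 Y1 phiE]]]] := riccati_coefficients oI dphi phi0 Pp gX1 X10.
set Y := Ad b X2 in Ym Y0 Y1.
have nilY : br Y (br Y (br Y X1)) = 0.
  rewrite -{1}[X1](AdVK Ae e1 b) /Y -!(Ad_bracket Ae e1 Hexp).
  rewrite (nilpotent_gm brl brr brC g_out g_full g_br _ gX2).
  by rewrite /Ad linear0.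
have disc := quadratic_discriminant brl brr brC jac g_out g_full g_direct g_br
  gX1 X10 Ym Y0 Y1 nilY.
have [||M HM] := riccati_mobius (phi := phi) oI _ _ disc.
- by move=> t It; rewrite -phiE //; exact: dphi.
- by move=> t It; rewrite -phiE //; exact: phi0.
by exists M => t It; rewrite phiE //; exact: HM.
Qed.

(** The identity between 2 x 2 matrices obtained from X = (0 0; 1 0),
H = diag(1, -1) and Z = (0 1; 0 0). At u = 0 both sides are exp (kap Z), and
both have logarithmic derivative X in u. *)
Lemma sl2_curve X H Z kap u : H \in g 0 -> Z \in g 1 ->
  br Z X = H -> br H X = - 2 *: X -> br H Z = 2 *: Z -> 0 < 1 + kap * u ->
  (exp (kap *: Z) * exp (u *: X) =
   exp ((u / (1 + kap * u)) *: X) * exp (ln (1 + kap * u) *: H) *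
   exp ((kap / (1 + kap * u)) *: Z))%g.
Proof.
move=> gH gZ ZX HX HZ u0.
pose J : set R := [set u | 0 < 1 + kap * u].
pose lam (u : R) := 1 + kap * u.
have dlam v : is_derive v (1 : R) lam kap.
  have K := is_deriveD (is_derive_cst (1 : R) v (1 : R))
    (is_derive_mulc kap (is_derive_id v (1 : R))).
  by apply: is_derive_eq K _; rewrite add0r mulr1.
have lamc : continuous lam.
  by move=> v; apply: differentiable_continuous; have [] := is_derive_diffE (dlam v).
have oJ : open J.
  by apply: (@open_comp _ _ lam [set x | 0 < x]); [move=> v _; exact: lamc|exact: open_gt].
have itvJ : is_interval J.
  move=> x y Jx Jy z /andP[xz zy]; rewrite /J /= in Jx Jy *.
  have [k0|k0] := leP 0 kap.
    by rewrite (lt_le_trans Jx) // lerD2l ler_wpM2l.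
  by rewrite (lt_le_trans Jy) // lerD2l ler_wnM2l // ltW.
have J0 : J 0 by rewrite /J /= mulr0 addr0.
apply: (@logder_uniq _ _ _ e Ae e1 J
  (fun u => exp (kap *: Z) * exp (u *: X))%g
  (fun u => exp ((u / lam u) *: X) * exp (ln (lam u) *: H) * exp ((kap / lam u) *: Z))%g
  (fun=> X) 0) => //.
- by move=> v _; apply: logder_lmul => //; exact: logder_exp.
- move=> v Jv; have l0 : lam v != 0 by rewrite gt_eqF.
  have dinv := is_derive_inv_fun (dlam v) l0.
  have dpsi : is_derive v (1 : R) (fun u => u / lam u) (lam v ^- 2).
    have K := is_deriveM (is_derive_id v (1 : R)) dinv.
    by apply: is_derive_eq K _; rewrite /GRing.scale /= /lam; field.
  have dz : is_derive v (1 : R) (fun u => kap / lam u) (- kap ^+ 2 / lam v ^+ 2).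
    by apply: is_derive_eq (is_derive_mulc kap dinv) _; field.
  have dln : is_derive v (1 : R) (fun u => ln (lam u)) (kap / lam v).
    have K := is_derive_chain (is_derive1_ln (Jv : 0 < lam v)) (dlam v).
    by apply: is_derive_eq K _.
  have L1 := logder_exp_fun Ae e1 Hexp X dpsi.
  have L2 := logder_exp_fun Ae e1 Hexp H dln.
  have L3 := logder_exp_fun Ae e1 Hexp Z dz.
  have := logder_mul Ae e1 (logder_mul Ae e1 L1 L2) L3.
  set w := _ + _; suff -> : w = X by [].
  have AdX : Ad (exp (ln (lam v) *: H))^-1%g X = lam v ^+ 2 *: X.
    rewrite (Ad_exp_inv_eigen Ae e1 Hexp _ HX); congr (_ *: _).
    by rewrite mulNr opprK mulrC expRM_natr lnK.
  rewrite /w AdZ AdX scalerA mulVf ?expf_neq0 // scale1r AdD AdZ.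
  have ZH : br Z H = - 2 *: Z by rewrite brC HZ scaleNr.
  have ZZ : br Z Z = 0 by rewrite (brxx brC).
  rewrite (Ad_exp_inv_quadratic Ae e1 Hexp); last first.
    by rewrite ZX ZH (brZr brl brr brC) ZZ scaler0.
  rewrite (Ad_exp_inv_quadratic Ae e1 Hexp); last first.
    by rewrite ZH !(brZr brl brr brC) ZZ (br0r brl brC) scaler0.
  rewrite ZX ZH (brZr brl brr brC) ZZ.
  by apply/rowP => j; rewrite !mxE; field.
- by rewrite /lam mulr0 addr0 ln1 !mul0r !scale0r (exp0 Hexp) !mulg1 mul1g divr1.
Qed.

(** With d the denominator at a base point t0 and u = (t - t0) / d^2,
the value at t is the value at t0 plus u / (1 + kap u), where
1 + kap u is the quotient of the denominators at t and t0, hence positive.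
Since u is affine in t, [sl2_curve] moves the geodesic with parameter u,
translated by exp (kap Z), onto the given curve. *)
Lemma flow_curve_mobius b X (M : 'M[R]_2) (I : set R) :
  X \in g (-1) -> (exists2 Z, Z \in g 1 & br X (br X Z) = X) ->
  \det M = 1 -> open_interval I -> (forall t, I t -> mobius_den M t != 0) ->
  is_geodesic_on exp g P I (fun t => flow_curve exp P b X (mobius M t)).
Proof.
move=> gX [Z0 gZ0 XXZ] detM [oI itv [t0 I0]] den0.
have [H [Z [gH gZ ZX HX HZ]]] := sl2_triple brl brr brC jac g_out g_br gX gZ0 XXZ.
pose d := mobius_den M t0; have d0 : d != 0 by exact: den0.
(* kap is chosen so that 1 + kap (t - t0) / d^2 is den t / d. *)
pose kap := M 1 0 * d.
pose phi0 := mobius M t0.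
have detE : M 0 0 * M 1 1 - M 0 1 * M 1 0 = 1.
  rewrite -detM (expand_det_row _ ord0) !big_ord_recl big_ord0 /cofactor.
  rewrite !det_mx11 !mxE /= addr0 expr0 mul1r expr1 mulN1r mulrN.
  by congr (M _ _ * M _ _ - M _ _ * M _ _); apply/val_inj.
exists (b * exp (phi0 *: X) * exp (kap *: Z) * exp ((- t0 / d ^+ 2) *: X))%g.
exists (d ^- 2 *: X); split; first exact: memvZ.
move=> t It; apply/left_coset_eq.
have de0 : mobius_den M t != 0 by exact: den0.
pose u := (t - t0) / d ^+ 2.
have lamE : 1 + kap * u = mobius_den M t / d.
  by rewrite /kap /u /d /mobius_den; field; exact: d0.
have lam0 : 0 < 1 + kap * u.
  by rewrite lamE; exact: mobius_den_sign itv den0 I0 It.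
have phiE : mobius M t = u / (1 + kap * u) + phi0.
  rewrite lamE /phi0 /mobius /u -/d.
  have E : mobius_num M t * d - mobius_num M t0 * mobius_den M t = t - t0.
    rewrite -[RHS]mul1r -detE /d /mobius_num /mobius_den; ring.
  have -> : mobius_num M t / mobius_den M t =
    (mobius_num M t * d - mobius_num M t0 * mobius_den M t) / (d * mobius_den M t) +
      mobius_num M t0 / d by field; rewrite d0 de0.
  by rewrite E; congr (_ + _); field; rewrite d0 de0.
have uE : u *: X = ((- t0 / d ^+ 2) + t / d ^+ 2) *: X.
  by congr (_ *: _); rewrite /u; ring.
rewrite scalerA -/(t / d ^+ 2).
have -> : (b * exp (phi0 *: X) * exp (kap *: Z) * exp ((- t0 / d ^+ 2) *: X) *
    exp ((t / d ^+ 2) *: X) = b * exp (phi0 *: X) * (exp (kap *: Z) * exp (u *: X)))%g.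
  by rewrite uE (exp_add Ae e1 Hexp) !mulgA.
rewrite (sl2_curve gH gZ ZX HX HZ lam0) phiE addrC (exp_add Ae e1 Hexp).
have cancel (x y z p q : G) : ((x * (y * z))^-1 * (x * y * (z * p * q)) = p * q)%g.
  by rewrite -[RHS](mulKg (x * (y * z))%g) !mulgA.
rewrite cancel.
have [gH' gZ'] : H \in (g 0 + g 1)%VS /\ Z \in (g 0 + g 1)%VS.
  by split; [exact: (subvP (addvSl _ _)) | exact: (subvP (addvSr _ _))].
by apply: PM; apply: P_exp; exact: memvZ.
Qed.

(** For the parameter change t / (1 + t) the Riccati equation is
phi' = (1 - phi)^2; three values of t determine its coefficients. *)
Lemma sl2_of_flow_curve_mobius b X : X \in g (-1) ->
  (forall M : 'M[R]_2, \det M = 1 -> forall I : set R, open_interval I ->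
     (forall t, I t -> mobius_den M t != 0) ->
     is_geodesic_on exp g P I (fun t => flow_curve exp P b X (mobius M t))) ->
  exists2 Z, Z \in g 1 & br X (br X Z) = X.
Proof.
move=> gX Hgeo; have [->|X0] := eqVneq X 0.
  by exists 0; [exact: mem0v|rewrite (br0l brl)].
pose M : 'M[R]_2 := mx22 1 0 1 1.
have detM : \det M = 1 by rewrite det_mx22; ring.
pose I : set R := [set` `](- 2^-1), 2^-1[%R].
have It k : - 2^-1 < k < 2^-1 -> I k by rewrite /I /= in_itv.
have oI : open_interval I.
  split; [exact: interval_open|exact: interval_is_interval|exists 0; apply: It].
  by apply/andP; split; lra.
have Ipos t : I t -> 0 < 1 * t + 1.
  by rewrite /I /= in_itv /= => /andP[h1 h2]; lra.
have denE t : mobius_den M t = 1 * t + 1 by rewrite /mobius_den !mxE.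
have den0 t : I t -> mobius_den M t != 0.
  by move=> /Ipos h; rewrite denE gt_eqF.
have [b' [X' [gX' Hc]]] := Hgeo M detM I oI den0.
have phiE t : mobius M t = t / (1 * t + 1) by rewrite mobius_mx22 addr0 !mul1r.
pose phi' (t : R) := (t + 1) ^- 2.
have dphi t : I t -> is_derive t (1 : R) (mobius M) (phi' t).
  move=> /Ipos h; have l0 : 1 * t + 1 != 0 by rewrite gt_eqF.
  have dl : is_derive t (1 : R) (fun t : R => 1 * t + 1) 1.
    have K := is_deriveD (is_derive_mulc 1 (is_derive_id t (1 : R)))
      (is_derive_cst (1 : R) t (1 : R)).
    by apply: is_derive_eq K _; rewrite addr0 mulr1.
  rewrite (_ : mobius M = (fun t => t / (1 * t + 1))); last by apply/funext.
  have K := is_deriveM (is_derive_id t (1 : R)) (is_derive_inv_fun dl l0).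
  apply: is_derive_eq K _; rewrite /GRing.scale /= /phi'; rewrite mul1r in l0 *.
  by field.
have phi0 t : I t -> phi' t != 0.
  by move=> /Ipos; rewrite mul1r => h; rewrite invr_eq0 expf_neq0 // gt_eqF.
have Pp t : I t -> P ((exp (mobius M t *: X))^-1 * (b^-1 * b') * exp (t *: X'))%g.
  move=> /Hc/left_coset_eq; congr P.
  by rewrite invgM !mulgA.
have [al [be [ga [_ _ Y1 E]]]] := riccati_coefficients oI dphi phi0 Pp gX X0.
have i0 : I 0 by apply: It; apply/andP; split; lra.
have i1 : I 3^-1 by apply: It; apply/andP; split; lra.
have i2 : I (- 3^-1) by apply: It; apply/andP; split; lra.
have ga1 : ga = 1.
  have := E _ i0; have := E _ i1; have := E _ i2.
  rewrite !phiE /phi'.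
  have -> : (- 3^-1 : R) / (1 * - 3^-1 + 1) = - 2^-1 by field.
  have -> : (3^-1 : R) / (1 * 3^-1 + 1) = 4^-1 by field.
  have -> : (0 : R) / (1 * 0 + 1) = 0 by rewrite mul0r.
  have -> : (- 3^-1 + 1 : R) ^- 2 = 9 / 4 by field.
  have -> : (3^-1 + 1 : R) ^- 2 = 9 / 16 by field.
  have -> : (0 + 1 : R) ^- 2 = 1 by rewrite add0r expr1n invr1.
  by rewrite !exprVn sqrrN !exprVn; lra.
exists (2^-1 *: pr1 (Ad (b^-1 * b')%g X')); first by rewrite memvZ // pr1_in.
by rewrite !(brZr brl brr brC) Y1 ga1 mulr1 scalerA mulVf ?scale1r // pnatr_eq0.
Qed.

End Geodesics.

(* In (1), \det M is the sign of phi': M is in SL(2,R) exactly when phi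
   preserves the orientation. Without this provision the claim fails for
   c^{b,-X}(t) = c^{b,X}(-t), because elements of SL(2,R) act increasingly. *)
Theorem proposition3p4 (R : realType) (n : nat) (G : lieGroupType R n)
    (e : chart R n G) (exp : 'rV[R]_n -> G)
    (g : int -> {vspace 'rV[R]_n}) (P : set G) :
  atlas e -> chart_dom e 1%g -> is_lie_exp e exp -> semisimple e ->
  is_grading1 e g -> is_parabolic exp g P ->
  (forall (b1 b2 : G) (X1 X2 : 'rV[R]_n),
     P b1 -> P b2 -> X1 \in g (-1) -> X2 \in g (-1) -> X1 != 0 -> X2 != 0 ->
     forall (I : set R) (phi : R -> R),
       open_interval I -> is_reparametrization I phi ->
       (forall t, I t ->
          flow_curve exp P b2 X2 t = flow_curve exp P b1 X1 (phi t)) ->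
       exists M : 'M[R]_2, forall t, I t ->
         [/\ \det M = Num.sg (derive1 phi t), mobius_den M t != 0 &
             phi t = mobius M t])
  /\
  (forall (b : G) (X : 'rV[R]_n), P b -> X \in g (-1) ->
     ((forall M : 'M[R]_2, \det M = 1 ->
       forall I : set R, open_interval I ->
         (forall t, I t -> mobius_den M t != 0) ->
         is_geodesic_on exp g P I (fun t => flow_curve exp P b X (mobius M t)))
      <->
      (exists2 Z, Z \in g 1 & lie_bracket e X (lie_bracket e X Z) = X))).
Proof.
move=> Ae e1 Hexp ss gr par; split.
  move=> b1 b2 X1 X2 _ _ gX1 gX2 X10 _ I phi oI [phis phi0] curves.
  have dphi t : I t -> is_derive t (1 : R) phi (derive1 phi t).
    move=> It; have [phid _] := phis 1%N.
    apply: DeriveDef; first by apply/derivable1_diffP; exact: phid.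
    by rewrite derive1E.
  apply: (geodesic_reparametrization Ae e1 Hexp ss gr par (b := (b1^-1 * b2)%g)
    oI dphi phi0 _ gX1 gX2 X10) => t It.
  have /(left_coset_eq par) := esym (curves t It).
  by congr P; rewrite invgM !mulgA.
move=> b X _ gX; split=> [Hgeo|sl2 M detM I oI den0].
  exact: (sl2_of_flow_curve_mobius Ae e1 Hexp ss gr par gX Hgeo).
exact: (flow_curve_mobius Ae e1 Hexp gr par b gX sl2 detM oI den0).
Qed.
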